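(* Let $\varepsilon>0$, $f\in\mathbb R[x]_{2d}$ and $g_i\in\mathbb R[x]_{2d_i}$ for $i=0,\dots,m$, with $g_0=1$ and $g_1=c(R-\|x\|_{\ell_2}^2)$ for some $R\in(0,1)$ and $c>0$, and let $k\ge\max\{d,d_0,\dots,d_m\}$. Let $S(g)=\{x\in\mathbb R^n: g_i(x)\ge0,\ i=1,\dots,m\}$, and let $\lambda_k$ be the value of the order-$k$ sum-of-squares relaxation of $\inf_{x\in S(g)}f(x)$. Suppose that: (a) there exist $\underline\lambda\in\mathbb R$ and a positive measure $\mu$ supported on $S(g)$ with $\underline\lambda\le\lambda_k$ and $\int(f-\underline\lambda)\,d\mu\,/\,\lambda_{\min}(D_k(g\mu))\le 1$; (b) $\|g_i\|_{\ell_1}\le1$ for $i=1,\dots,m$. Assume strong duality holds for the order-$k$ sum-of-squares and moment relaxations. Let $\lambda_k^{(\varepsilon)}$ be the value returned by the algorithm CON (described in the context), run with $\varepsilon$, $\underline\lambda$ and a point $a\in S(g)$. Then $$0\le \lambda_k^{(\varepsilon)}-\lambda_k\le\varepsilon\left(2+\frac{1}{1-R}\sqrt{\frac12\binom{n+k}n\left[\binom{n+k}n+1\right]}\ \right).$$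
   Context: Notation. $\mathbb N^n_t=\{\alpha\in\mathbb N^n:|\alpha|\le t\}$; $\mathbb R[x]_t$: real polynomials in $x=(x_1,\dots,x_n)$ of degree at most $t$; $f=\sum f_\alpha x^\alpha$, $g_i=\sum g_{i,\alpha}x^\alpha$; $d=\lceil\deg(f)/2\rceil$, $d_i=\lceil\deg(g_i)/2\rceil$; $\|p\|_{\ell_1}$ is the sum of absolute values of the coefficients of $p$; $v_t=(x^\alpha)_{\alpha\in\mathbb N^n_t}$; $\mathbb S^N$: real symmetric $N\times N$ matrices. For $y=(y_\alpha)_{\alpha\in\mathbb N^n_{2k}}$: $M_k(y)=(y_{\alpha+\beta})_{\alpha,\beta\in\mathbb N^n_k}$; $M_{k-d_i}(g_iy)=(\sum_\gamma g_{i,\gamma}y_{\alpha+\beta+\gamma})_{\alpha,\beta\in\mathbb N^n_{k-d_i}}$; $L_y(\sum p_\alpha x^\alpha)=\sum p_\alpha y_\alpha$; $D_k(gy)=\operatorname{diag}((M_{k-d_i}(g_iy))_{i=0,\dots,m})$. For a measure $\mu$ with finite moments, $D_k(g\mu)=D_k(gy)$ with $y_\alpha=\int x^\alpha d\mu$. $\lambda_{\min}(\cdot)$ of a matrix is its smallest eigenvalue (implicitly positive in (a)). Relaxations. SOS: $\lambda_k=\sup\{\lambda:\ \lambda\in\mathbb R,\ G=\operatorname{diag}(G_0,\dots,G_m)\succeq0,\ f-\lambda=\sum_{i=0}^mg_iv_{k-d_i}^\top G_iv_{k-d_i}\}$. Moment: $\tau_k=\min\{L_y(f): y=(y_\alpha)_{\alpha\in\mathbb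 N^n_{2k}},\ y_0=1,\ M_k(y)\succeq0,\ M_{k-d_i}(g_iy)\succeq0,\ i=1,\dots,m\}$. Strong duality means $\lambda_k=\tau_k$ and both problems have optimal solutions. Hamiltonian updates HU. Input: $\varepsilon>0$, $A'_1,\dots,A'_{M'}\in\mathbb S^N$, $b'_1,\dots,b'_{M'}\in\mathbb R$ (encoding: find $X\succeq0$ with $\operatorname{tr}X=1$, $\operatorname{tr}(A'_jX)\le b'_j$ for all $j$). Set $W^{(1)}=I_N$ and $T'=\lceil 16\log(N)/\varepsilon^2\rceil$. For $t=1,\dots,T'$: set $P^{(t)}=W^{(t)}/\operatorname{tr}(W^{(t)})$; if some $j^{(t)}$ satisfies $\operatorname{tr}(A'_{j^{(t)}}P^{(t)})>b'_{j^{(t)}}+\varepsilon$, choose one and set $M^{(t)}=\frac12(I_N-A'_{j^{(t)}})$; otherwise stop with output $\eta=1$. Set $W^{(t+1)}=\exp\big(\frac{\varepsilon}{4}\sum_{s=1}^tM^{(s)}\big)$. If the loop completes, output $\eta=0$. Binary search BS. Input: $C,A_1,\dots,A_M\in\mathbb S^N$, $b\in\mathbb R^M$, reals $\lambda_{\min}<\lambda_{\max}$, $\varepsilon>0$. Set $\underline\lambda_0=\lambda_{\min}$, $\overline\lambda_0=\lambda_{\max}$, $T=\lceil\log_2((\lambda_{\max}-\lambda_{\min})/\varepsilon)\rceil$ (no iterations if $T\le 0$). For $t=0,\dots,T-1$: let $\lambda_t=(\underline\lambda_t+\overline\lambda_t)/2$; run HU with accuracy $\varepsilon$ on the constraints $\operatorname{tr}(A_iX)\le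 b_i$, $\operatorname{tr}(-A_iX)\le -b_i$ ($i=1,\dots,M$), $\operatorname{tr}(CX)\le\lambda_t$; if $\eta=0$ set $(\underline\lambda_{t+1},\overline\lambda_{t+1})=(\lambda_t,\overline\lambda_t)$, if $\eta=1$ set $(\underline\lambda_{t+1},\overline\lambda_{t+1})=(\underline\lambda_t,\lambda_t)$. Output: the final lower value $\underline\lambda_T$. Algorithm CON. For $i=0,\dots,m$ and $\eta\in\mathbb N^n$, let $B_i^{(\eta)}$ be the matrix indexed by $\mathbb N^n_{k-d_i}$ with $(\alpha,\beta)$-entry $1$ if $\alpha+\beta=\eta$ and $0$ otherwise. For $\gamma\in\mathbb N^n_{2k}$ put $B_g^{(\gamma)}=\operatorname{diag}\big(\big(\sum_{\zeta\in\mathbb N^n_{2d_i},\,\gamma-\zeta\in\mathbb N^n}g_{i,\zeta}B_i^{(\gamma-\zeta)}\big)_{i=0,\dots,m}\big)$. Enumerate $\mathbb N^n_{2k}=\{\gamma_0=0,\gamma_1,\dots,\gamma_M\}$, $M=\binom{n+2k}{n}-1$. Put $C=\operatorname{diag}(B_g^{(0)},0)$, $A_i=\operatorname{diag}(B_g^{(\gamma_i)},0)$, $b_i=f_{\gamma_i}$ ($i=1,\dots,M$), of size $N=1+\sum_{i=0}^m\binom{n+k-d_i}{n}$; $\lambda_{\min}=f_0-f(a)$, $\lambda_{\max}=f_0-\underline\lambda$ (with $\lambda_{\min}<\lambda_{\max}$ as required by BS). Run BS and return $\lambda_k^{(\varepsilon)}=f_0-\underline\lambda_T$. *)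

(* Defs.v *)
(* MathComp-Analysis and multinomials.  The notations of mpoly are incompatible
   with those of MathComp-Analysis, hence the notation-free import. *)
From HB Require Import structures.
From mathcomp Require Import all_boot all_order all_algebra.
From mathcomp Require Import all_classical all_reals all_analysis.
From mathcomp Require Import -(notations) mpoly.

Set Implicit Arguments.
Unset Strict Implicit.
Unset Printing Implicit Defensive.

Import Order.TTheory GRing.Theory Num.Theory.
Import numFieldNormedType.Exports.

Local Open Scope classical_set_scope.
Local Open Scope ring_scope.

(* ceil (deg p / 2); msize p is 1 + deg p, and the zero polynomial gets 0. *)
Definition halfdeg (R : realType) n (p : mpoly n R) : nat := uphalf (msize p).-1.

Definition l1norm (R : realType) n (p : mpoly n R) : R :=
  \sum_(e <- msupp p) `|mcoeff e p|.

Definition evalp (R : realType) n (p : mpoly n R) (x : n.-tuple R) : R :=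
  meval (tnth x) p.

(* The exponents of degree at most t are the elements of bmultinom n t.+1
   (degree < t.+1); matrices indexed by them use their fixed enumeration. *)
Definition nmon (n t : nat) : nat := #|{: bmultinom n t.+1}|.

Definition mon (n t : nat) (i : 'I_(nmon n t)) : multinom n :=
  bmnm (enum_val i).

Definition vmon (R : realType) n t : 'cV[mpoly n R]_(nmon n t) :=
  \col_i mpolyX R (mon i).

Definition ball_poly (R : realType) n (c r : R) : mpoly n R :=
  mpolyC n c * (mpolyC n r - \sum_(i < n) mpolyX R (mnm1 i) ^+ 2).

(* The constraint g 0 (which is 1) is not part of the description of S(g). *)
Definition Sset (R : realType) n m (g : 'I_m.+1 -> mpoly n R) :
    set (n.-tuple R) :=
  [set x | forall i : 'I_m.+1, (0 < i)%N -> 0 <= evalp (g i) x].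

Definition psd (R : realType) N (A : 'M[R]_N) : Prop :=
  A^T = A /\ forall u : 'cV[R]_N, 0 <= (u^T *m A *m u) 0 0.

(* Smallest eigenvalue of a symmetric matrix of positive size (finitely many
   eigenvalues, at least one, so that the infimum is a minimum). *)
Definition lambda_min (R : realType) N (A : 'M[R]_N) : R :=
  inf [set l | eigenvalue A l].

(* The exponential series is taken entrywise. *)
Definition expmx (R : realType) N (A : 'M[R]_N) : 'M[R]_N :=
  \matrix_(i, j) limn (series (fun s : nat => (A ^+ s) i j / s`!%:R)).

Definition Ly (R : realType) n (y : multinom n -> R) (p : mpoly n R) : R :=
  \sum_(e <- msupp p) mcoeff e p * y e.

Definition momentmx (R : realType) n t (y : multinom n -> R) : 'M[R]_(nmon n t) :=
  \matrix_(i, j) y (mnm_add (mon i) (mon j)).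

Definition locmx (R : realType) n t (p : mpoly n R) (y : multinom n -> R) :
    'M[R]_(nmon n t) :=
  \matrix_(i, j)
    \sum_(e <- msupp p) mcoeff e p * y (mnm_add (mnm_add (mon i) (mon j)) e).

Definition blk (R : realType) n m (g : 'I_m.+1 -> mpoly n R) (k : nat)
  (i : 'I_m.+1) : nat := nmon n (k - halfdeg (g i)).

Definition momdiag (R : realType) n m (g : 'I_m.+1 -> mpoly n R) (k : nat)
    (y : multinom n -> R) : 'M[R]_(\sum_i blk g k i) :=
  mxdiag (fun i : 'I_m.+1 => locmx (k - halfdeg (g i)) (g i) y).

(* A truncated sequence (y_a), |a| <= t, seen as a full sequence.  The padding
   value is irrelevant: with t = 2k the order-k matrices only read |a| <= 2k. *)
Definition pad (R : realType) n t (y : bmultinom n t.+1 -> R) (e : multinom n) :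
    R := oapp y 0 (insub e).

Definition evalmon (R : realType) n (e : multinom n) (x : n.-tuple R) : R :=
  mmap1 (tnth x) e.

Definition finite_moments (R : realType) n
    (mu : {measure set (n.-tuple R) -> \bar R}) : Prop :=
  forall e : multinom n, mu.-integrable setT (EFin \o evalmon e).

Definition moments (R : realType) n
    (mu : {measure set (n.-tuple R) -> \bar R}) (e : multinom n) : R :=
  Rintegral mu setT (evalmon e).

Definition sos_feasible (R : realType) n m (f : mpoly n R)
    (g : 'I_m.+1 -> mpoly n R) (k : nat) (l : R)
    (G : forall i : 'I_m.+1, 'M[R]_(blk g k i)) : Prop :=
  psd (mxdiag G) /\
  f - mpolyC n l = \sum_(i < m.+1) g i *
    ((vmon R n (k - halfdeg (g i)))^T *m map_mx (@mpolyC n R) (G i)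
      *m vmon R n (k - halfdeg (g i))) 0 0.

Arguments sos_feasible {R n m} f g k l G.

Definition mom_feasible (R : realType) n m (g : 'I_m.+1 -> mpoly n R) (k : nat)
    (y : bmultinom n (2 * k).+1 -> R) : Prop :=
  [/\ pad y mnm0 = 1,
      psd (momentmx k (pad y)) &
      forall i : 'I_m.+1, (0 < i)%N ->
        psd (locmx (k - halfdeg (g i)) (g i) (pad y))].

Arguments mom_feasible {R n m} g k y.

Definition sos_value (R : realType) n m (f : mpoly n R)
    (g : 'I_m.+1 -> mpoly n R) (k : nat) : \bar R :=
  ereal_sup [set z | exists l G, sos_feasible f g k l G /\ z = l%:E].

Definition mom_value (R : realType) n m (f : mpoly n R)
    (g : 'I_m.+1 -> mpoly n R) (k : nat) : \bar R :=
  ereal_inf [set z | exists y, mom_feasible g k y /\ z = (Ly (pad y) f)%:E].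

Definition strong_duality (R : realType) n m (f : mpoly n R)
    (g : 'I_m.+1 -> mpoly n R) (k : nat) : Prop :=
  [/\ sos_value f g k = mom_value f g k,
      exists l G, sos_feasible f g k l G /\ l%:E = sos_value f g k &
      exists y, mom_feasible g k y /\ (Ly (pad y) f)%:E = mom_value f g k].

(* The ceiling of x, or 0 if it is negative. *)
Definition ceil_nat (R : realType) (x : R) : nat :=
  if Num.ceil x is Posz s then s else 0.

(* Since a violated constraint is picked arbitrarily, HU is the relation
   "eta is a possible output" (true for 1, false for 0).  In HU_loop, fuel is
   the number of remaining rounds, H the sum of the M^(s) so far, and W the
   current W^(t). *)
Fixpoint HU_loop (R : realType) N (J : finType) (A : J -> 'M[R]_N) (b : J -> R)
    (eps : R) (fuel : nat) (H W : 'M[R]_N) (eta : bool) : Prop :=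
  if fuel is fuel'.+1 then
    let P := (\tr W)^-1 *: W in
    ((forall j, ~ (\tr (A j *m P) > b j + eps)) /\ eta = true) \/
    (exists j, \tr (A j *m P) > b j + eps /\
       let H' := H + 2^-1 *: (1%:M - A j) in
       HU_loop A b eps fuel' H' (expmx ((eps / 4) *: H')) eta)
  else eta = false.

Definition HU (R : realType) N (J : finType) (A : J -> 'M[R]_N) (b : J -> R)
    (eps : R) (eta : bool) : Prop :=
  HU_loop A b eps (ceil_nat (16 * ln N%:R / eps ^+ 2)) 0 1%:M eta.

Definition bs_mx (R : realType) N (I : finType) (C : 'M[R]_N) (A : I -> 'M[R]_N)
    (j : I + I + unit) : 'M[R]_N :=
  match j with
  | inl (inl i) => A i
  | inl (inr i) => - A i
  | inr tt => C
  end.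

Definition bs_rhs (R : realType) (I : finType) (b : I -> R) (l : R)
    (j : I + I + unit) : R :=
  match j with
  | inl (inl i) => b i
  | inl (inr i) => - b i
  | inr tt => l
  end.

Fixpoint BS_loop (R : realType) N (I : finType) (C : 'M[R]_N)
    (A : I -> 'M[R]_N) (b : I -> R) (eps : R) (rounds : nat) (lo hi out : R) :
    Prop :=
  if rounds is rounds'.+1 then
    let mid := (lo + hi) / 2 in
    exists eta : bool, HU (bs_mx C A) (bs_rhs b mid) eps eta /\
      if eta then BS_loop C A b eps rounds' lo mid out
      else BS_loop C A b eps rounds' mid hi out
  else out = lo.

(* "out is a possible output" *)
Definition BS (R : realType) N (I : finType) (C : 'M[R]_N) (A : I -> 'M[R]_N)
    (b : I -> R) (lmin lmax eps : R) (out : R) : Prop :=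
  BS_loop C A b eps (ceil_nat (ln ((lmax - lmin) / eps) / ln 2)) lmin lmax out.

Definition Bmx (R : realType) n t (e : multinom n) : 'M[R]_(nmon n t) :=
  \matrix_(i, j) (mnm_add (mon i) (mon j) == e)%:R.

Definition Bgmx (R : realType) n m (g : 'I_m.+1 -> mpoly n R) (k : nat)
    (e : multinom n) : 'M[R]_(\sum_i blk g k i) :=
  mxdiag (fun i : 'I_m.+1 =>
    \sum_(z : bmultinom n (2 * halfdeg (g i)).+1 | lem (bmnm z) e)
      mcoeff (bmnm z) (g i) *:
        Bmx R (k - halfdeg (g i)) (mnm_sub e (bmnm z))).

Definition slack (R : realType) N (A : 'M[R]_N) : 'M[R]_(N + 1) :=
  block_mx A 0 0 0.

(* The nonzero exponents of degree at most 2k index the equality constraints. *)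
Definition nzmon (n k : nat) : finType :=
  {e : bmultinom n (2 * k).+1 | bmnm e != mnm0}.

(* "out is a possible value returned by CON on f, g, k, eps, lam and a" *)
Definition CON (R : realType) n m (f : mpoly n R) (g : 'I_m.+1 -> mpoly n R)
    (k : nat) (eps lam : R) (a : n.-tuple R) (out : R) : Prop :=
  let f0 := mcoeff mnm0 f in
  exists l : R,
    BS (slack (Bgmx g k mnm0))
       (fun e : nzmon n k => slack (Bgmx g k (bmnm (val e))))
       (fun e : nzmon n k => mcoeff (bmnm (val e)) f)
       (f0 - evalp f a) (f0 - lam) eps l /\
    out = f0 - l.

(* Main.v *)
(* Let v = f_0 - lambda_k.  The bisection keeps its lower end below v and its
   upper end above v - eps (1 + sum_{g <> 0} |y_g|), where y is an optimal moment
   sequence.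

   Lower end.  Integrating f - lambda_k against mu bounds the trace of an optimal
   Gram matrix by 1, so with the slack entry it becomes an exactly feasible
   density matrix X at every level >= v.  HU then cannot run through all its
   rounds: the potential ln tr exp H - tr (X H) is nonnegative, starts at ln N,
   and drops by at least 3 eps^2 / 32 in each round.  The drop is obtained without
   the Golden-Thompson inequality, from the nonnegativity of the relative entropy
   of consecutive Gibbs states (which evaluates the new gradient at the new state)
   and a Pinsker-type stability bound (which moves it back to the old state).

   Upper end.  If HU stops early, pairing its approximate solution with the moment
   matrices of y is weak duality up to an error eps on each coefficient.

   Finally the ball constraint makes the diagonal moments of degree 2j sum to at
   most r^j, hence tr M_k(y) <= 1 / (1 - r), and the moments of degree <= 2k are
   among the entries of M_k(y) on or above the diagonal. *)
Require Import Defs.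
From HB Require Import structures.
From mathcomp Require Import all_boot all_order all_algebra.
From mathcomp Require Import all_classical all_reals all_analysis.
From mathcomp Require Import -(notations) mpoly.
From mathcomp Require Import ssrcomplements.
From mathcomp Require Import -(notations) complex.
From mathcomp Require Import ring lra zify.

Set Implicit Arguments.
Unset Strict Implicit.
Unset Printing Implicit Defensive.

Import Order.TTheory GRing.Theory Num.Theory.
Import numFieldNormedType.Exports.

Local Open Scope classical_set_scope.
Local Open Scope ring_scope.

(** * Real spectral theorem *)

Lemma quad_id (R : realType) n (v : 'rV[R]_n) :
  (v *m v^T) 0 0 = \sum_i v 0 i ^+ 2.
Proof. by rewrite mxE; apply: eq_bigr => i _; rewrite mxE expr2. Qed.

Lemma quad_id_gt0 (R : realType) n (v : 'rV[R]_n) :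
  v != 0 -> 0 < (v *m v^T) 0 0.
Proof.
move=> v0; rewrite quad_id lt_neqAle sumr_ge0 ?andbT; last first.
  by move=> i _; exact: sqr_ge0.
apply: contra v0; rewrite eq_sym psumr_eq0 => [/allP v0|i _]; last exact: sqr_ge0.
apply/eqP/rowP => i; rewrite mxE; apply/eqP.
by rewrite -sqrf_eq0; apply: v0; rewrite mem_index_enum.
Qed.

(** The complex spectral theorem applies to [A] viewed as a Hermitian matrix with real entries; its
    first eigenvalue is real, and a real eigenvector is recovered through the characteristic
    polynomial and then normalised. *)
Lemma real_sym_eigenvector (R : realType) n (A : 'M[R]_n.+1) : A^T = A ->
  exists a (v : 'rV[R]_n.+1), v *m v^T = 1%:M /\ v *m A = a *: v.
Proof.
move=> As.
pose toC := @real_complex_def R (Phant R).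
pose AC := map_mx toC A.
have symA : AC \is symmetricmx.
  by apply/is_hermitianmxP; rewrite expr0 scale1r map_mx_id // /AC map_trmx As.
have reA : AC \is a mxOver Num.real.
  by apply/mxOverP => i j; rewrite mxE; apply/complex_realP; exists (A i j).
have /hermitian_spectral_diag_real := realsym_hermsym symA reA.
move=> /mxOverP /(_ 0 0) /complex_realP [a ea].
have /orthomx_spectralP := symmetric_normalmx symA reA.
set P := spectralmx AC; set d := spectral_diag AC in ea * => eA.
have uP : P \in unitmx by exact: spectral_unit.
have : eigenvalue AC (toC a).
  apply/eigenvalueP; exists (row 0 P).
    rewrite -row_mul {1}eA 2!mulmxA mulmxV // mul1mx row_mul.
    suff -> : row 0 (diag_mx d) = toC a *: delta_mx 0 0.
      by rewrite -scalemxAl -rowE.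
    apply/rowP => j; by rewrite !mxE ea eq_sym /= mulr_natr.
  apply/eqP => P0; have := mulmxV uP => /(congr1 (row 0)).
  rewrite row_mul P0 mul0mx => /rowP /(_ 0); rewrite !mxE eqxx /=.
  by move/eqP; rewrite eq_sym oner_eq0.
(* The characteristic polynomial of [AC] is the image of that of [A], so the real number [a] is
   already a root over [R]. *)
rewrite eigenvalue_root_char -map_char_poly fmorph_root -eigenvalue_root_char.
move=> /eigenvalueP [v vA v0].
have s0 := quad_id_gt0 v0; set s := (v *m v^T) 0 0 in s0.
exists a, ((Num.sqrt s)^-1 *: v); split.
  rewrite linearZ /= -scalemxAl -scalemxAr scalerA [v *m _]mx11_scalar -/s.
  rewrite scale_scalar_mx -invfM -expr2 sqr_sqrtr ?ltW // mulVf //.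
  by rewrite gt_eqF.
by rewrite -scalemxAl vA scalerA mulrC -scalerA.
Qed.

(** The witness is the Householder reflection along [w = v - e], which exchanges the first basis
    vector [e] and [v]; the case [v = e], where [w] vanishes, is separate. *)
Lemma orthogonal_completion (R : realType) n (v : 'rV[R]_n.+1) :
  v *m v^T = 1%:M ->
  exists U : 'M[R]_n.+1, U *m U^T = 1%:M /\ row 0 U = v.
Proof.
move=> v1; pose e : 'rV[R]_n.+1 := delta_mx 0 0.
have [->|] := eqVneq v e.
  by exists 1%:M; rewrite trmx1 mulmx1; split=> //; rewrite row1.
rewrite -subr_eq0; set w := v - e => /quad_id_gt0; set s := (_ 0 0) => s0.
have ws : w *m w^T = s%:M by rewrite [LHS]mx11_scalar.
have ee : e *m e^T = 1%:M.
  by rewrite /e trmx_delta mul_delta_mx; apply/matrixP => i j; rewrite !ord1 !mxE.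
have ve : v *m e^T = (e *m v^T).
  by rewrite -[LHS]trmxK trmx_mul trmxK; apply/matrixP => i j; rewrite !ord1 !mxE.
(* Since [v] and [e] are both unit vectors, [s] is [2 - 2 <e, v>], hence [<e, w> = - s / 2]; the
   reflection therefore sends [e] to [e + w = v]. *)
have ew : e *m w^T = (- (s / 2))%:M.
  have : w *m w^T = - (e *m w^T) - (e *m w^T).
    by rewrite /w linearB /= !mulmxBl !mulmxBr v1 ve ee !opprB.
  rewrite ws [e *m w^T]mx11_scalar; set t := (e *m w^T) 0 0.
  move=> /matrixP /(_ 0 0); rewrite !mxE !eqxx !mulr1n => ->.
  by congr (_%:M); field.
have ew0 : v = e + w by rewrite /w addrC subrK.
move: w @s s0 ws ew ew0 => w s s0 ws ew ->.
exists (1%:M - (2 / s) *: (w^T *m w)); split.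
  rewrite [in X in _ *m X]linearB /= trmx1 [in X in _ *m X]linearZ /=.
  rewrite trmx_mul trmxK mulmxBl !mulmxBr !mul1mx !mulmx1.
  rewrite -!scalemxAl -!scalemxAr scalerA.
  rewrite mulmxA -(mulmxA _ w w^T) ws mul_mx_scalar -scalemxAl scalerA.
  have -> : 2 / s * (2 / s) * s = 2 / s + 2 / s.
    by field; rewrite gt_eqF.
  by rewrite scalerDl opprB addrK subrK.
rewrite rowE -/e mulmxBr mulmx1 -scalemxAr mulmxA ew mul_scalar_mx scalerA.
have -> : 2 / s * - (s / 2) = - 1 by field; rewrite gt_eqF.
by rewrite scaleN1r opprK.
Qed.

(** Deflation: in an orthonormal basis starting with an eigenvector, symmetry makes the first row
    and column vanish off the diagonal, and induction handles the remaining block. *)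
Lemma real_spectral (R : realType) n (A : 'M[R]_n) : A^T = A ->
  exists (U : 'M[R]_n) (d : 'rV[R]_n),
    U *m U^T = 1%:M /\ A = U *m diag_mx d *m U^T.
Proof.
elim: n A => [|n IH] A As.
  by exists 1%:M, 0; split; apply/matrixP => -[].
have [a [v [v1 vA]]] := real_sym_eigenvector As.
have [U [UU rU]] := orthogonal_completion v1.
have UtU : U^T *m U = 1%:M by exact: mulmx1C.
pose B : 'M[R]_(1 + n) := U *m A *m U^T.
have Bs : B^T = B by rewrite /B !trmx_mul trmxK As mulmxA.
have rB : row 0 B = a *: delta_mx 0 0.
  by rewrite /B !row_mul rU vA -scalemxAl -rU -row_mul UU row1.
have AE : A = U^T *m B *m U.
  by rewrite /B !mulmxA UtU mul1mx -mulmxA UtU mulmx1.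
clearbody B.
have B0 (i : 'I_1) j : B (lshift n i) j = a * (j == lshift n (0 : 'I_1))%:R.
  have -> : lshift n i = 0 :> 'I_n.+1 by apply/val_inj; rewrite /= ord1.
  have -> : lshift n (0 : 'I_1) = 0 :> 'I_n.+1 by apply/val_inj.
  by have /rowP /(_ j) := rB; rewrite !mxE.
have eB : B = block_mx a%:M 0 0 (drsubmx B).
  rewrite -[LHS]submxK; congr block_mx; apply/matrixP => i j.
  - by rewrite !mxE B0 !ord1 eqxx mulr1 mulr1n.
  - by rewrite !mxE B0 eq_rlshift mulr0.
  - by rewrite -[in LHS]Bs !mxE B0 eq_rlshift mulr0.
have [Q [d [QQ eD]]] : exists (Q : 'M[R]_n) (d : 'rV[R]_n),
    Q *m Q^T = 1%:M /\ drsubmx B = Q *m diag_mx d *m Q^T.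
  by apply: IH; rewrite trmx_drsub Bs.
pose V : 'M[R]_(1 + n) := block_mx 1%:M 0 0 Q.
have VV : V *m V^T = 1%:M.
  rewrite /V tr_block_mx mulmx_block !trmx0 trmx1 !mulmx1 !mul0mx !mulmx0 QQ.
  by rewrite addr0 !add0r -scalar_mx_block.
have VD : B = V *m diag_mx (row_mx a%:M d) *m V^T.
  rewrite eB diag_mx_row /V tr_block_mx !mulmx_block !trmx0 trmx1.
  rewrite !(mulmx0, mul0mx, mulmx1, mul1mx, addr0, add0r) eD.
  by congr block_mx; apply/matrixP => i j; rewrite !ord1 !mxE.
exists (U^T *m V), (row_mx a%:M d : 'rV[R]_(1 + n)); split.
  by rewrite trmx_mul trmxK mulmxA -(mulmxA _ V) VV mulmx1.
by rewrite AE VD trmx_mul trmxK !mulmxA.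
Qed.

(** The spectrum is a function, so that applying a scalar function to a symmetric matrix is
    composition with [p]. The columns of [U] are the eigenvectors when [U] is orthogonal. *)
Definition spec (R : realType) n (U : 'M[R]_n) (p : 'I_n -> R) : 'M[R]_n :=
  U *m diag_mx (\row_l p l) *m U^T.

Definition orthogonal (R : realType) n (U : 'M[R]_n) : Prop := U *m U^T = 1%:M.

Lemma real_spec (R : realType) n (A : 'M[R]_n) : A^T = A ->
  exists (U : 'M[R]_n) (d : 'I_n -> R), orthogonal U /\ A = spec U d.
Proof.
move=> /real_spectral [U [d [UU ->]]]; exists U, (d 0); split=> //.
by rewrite /spec; congr (_ *m diag_mx _ *m _); apply/rowP => j; rewrite mxE.
Qed.

Lemma orthogonal_trmx (R : realType) n (U : 'M[R]_n) :
  orthogonal U -> U^T *m U = 1%:M.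
Proof. exact: mulmx1C. Qed.

Lemma specE (R : realType) n (U : 'M[R]_n) p i j :
  spec U p i j = \sum_l p l * (U i l * U j l).
Proof.
rewrite /spec mxE; apply: eq_bigr => l _.
rewrite mul_mx_diag !mxE; ring.
Qed.

Lemma spec_trmx (R : realType) n (U : 'M[R]_n) p : (spec U p)^T = spec U p.
Proof.
by apply/matrixP => i j; rewrite mxE !specE; apply: eq_bigr => l _; ring.
Qed.

Lemma specD (R : realType) n (U : 'M[R]_n) p q :
  spec U p + spec U q = spec U (fun l => p l + q l).
Proof.
apply/matrixP => i j; rewrite mxE !specE -big_split; apply: eq_bigr => l _ /=.
ring.
Qed.

Lemma specZ (R : realType) n (U : 'M[R]_n) c p :
  c *: spec U p = spec U (fun l => c * p l).
Proof.
apply/matrixP => i j; rewrite mxE !specE mulr_sumr; apply: eq_bigr => l _ /=.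
ring.
Qed.

Lemma eq_spec (R : realType) n (U : 'M[R]_n) p q : p =1 q ->
  spec U p = spec U q.
Proof.
by move=> pq; apply/matrixP => i j; rewrite !specE; apply: eq_bigr => l _; rewrite pq.
Qed.

Lemma spec1 (R : realType) n (U : 'M[R]_n) : orthogonal U ->
  spec U (fun=> 1) = 1%:M.
Proof.
move=> <-; apply/matrixP => i j; rewrite specE mxE; apply: eq_bigr => l _.
by rewrite !mxE mul1r.
Qed.

Lemma specM (R : realType) n (U : 'M[R]_n) p q : orthogonal U ->
  spec U p *m spec U q = spec U (fun l => p l * q l).
Proof.
move=> /orthogonal_trmx UU; rewrite /spec !mulmxA -(mulmxA _ _ U) UU mulmx1.
rewrite -(mulmxA U); congr (_ *m _ *m _); apply/matrixP => i j.
rewrite mul_mx_diag !mxE; case: (eqVneq i j) => [->|_]; first by rewrite !mulr1n.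
by rewrite !mulr0n mul0r.
Qed.

Lemma tr_mul_spec (R : realType) n (M U : 'M[R]_n) p :
  \tr (M *m spec U p) = \sum_l p l * (U^T *m M *m U) l l.
Proof.
rewrite /spec mxtrace_mulC -!mulmxA mxtrace_mulC -mulmxA /mxtrace.
apply: eq_bigr => l _; rewrite mul_diag_mx mxE mxE; congr (_ * _).
by rewrite -mulmxA.
Qed.

Lemma tr_spec (R : realType) n (U : 'M[R]_n) p : orthogonal U ->
  \tr (spec U p) = \sum_l p l.
Proof.
move=> /orthogonal_trmx UU; rewrite -[spec U p]mul1mx tr_mul_spec mulmx1 UU.
by apply: eq_bigr => l _; rewrite mxE eqxx mulr1.
Qed.

(** Two noncommuting matrices interact only through the squared overlaps of their eigenbases, which
    turns the trace into a scalar double sum. *)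
Lemma tr_spec_spec (R : realType) n (U V : 'M[R]_n) p q :
  \tr (spec U p *m spec V q) =
  \sum_l \sum_j (U^T *m V) l j ^+ 2 * (p l * q j).
Proof.
rewrite tr_mul_spec exchange_big; apply: eq_bigr => j _ /=.
have -> : V^T *m spec U p *m V = (U^T *m V)^T *m diag_mx (\row_l p l) *m (U^T *m V).
  by rewrite /spec trmx_mul trmxK !mulmxA.
rewrite mxE mulr_sumr; apply: eq_bigr => l _.
rewrite mul_mx_diag !mxE; ring.
Qed.

Lemma psd_spec (R : realType) n (U : 'M[R]_n) p : (forall l, 0 <= p l) ->
  psd (spec U p).
Proof.
move=> p0; split=> [|u]; first exact: spec_trmx.
have -> : u^T *m spec U p *m u = (U^T *m u)^T *m diag_mx (\row_l p l) *m (U^T *m u).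
  by rewrite /spec trmx_mul trmxK !mulmxA.
rewrite mxE sumr_ge0 // => l _; rewrite mul_mx_diag mxE [(_^T) _ _]mxE.
by rewrite mulrAC mulr_ge0 ?mxE // -expr2 sqr_ge0.
Qed.

Lemma psd_conj_diag (R : realType) n (A U : 'M[R]_n) l : psd A ->
  0 <= (U^T *m A *m U) l l.
Proof.
move=> [_ /(_ (col l U))]; rewrite tr_col -row_mul.
suff -> : (row l (U^T *m A) *m col l U) 0 0 = (U^T *m A *m U) l l by [].
by rewrite mxE [RHS]mxE; apply: eq_bigr => j _; rewrite !mxE.
Qed.

Lemma psd_spec_ge0 (R : realType) n (U : 'M[R]_n) d l :
  orthogonal U -> psd (spec U d) -> 0 <= d l.
Proof.
move=> UU /(psd_conj_diag U l); rewrite /spec !mulmxA (orthogonal_trmx UU) mul1mx.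
by rewrite -mulmxA (orthogonal_trmx UU) mulmx1 !mxE eqxx.
Qed.

Lemma psd_tr_mul_ge0 (R : realType) n (A B : 'M[R]_n) : psd A -> psd B ->
  0 <= \tr (A *m B).
Proof.
move=> pA pB; have [Bs _] := pB; have [U [d [UU eB]]] := real_spec Bs.
rewrite eB in pB *; rewrite tr_mul_spec sumr_ge0 // => l _.
by apply: mulr_ge0; [exact: psd_spec_ge0 pB | exact: psd_conj_diag].
Qed.

(** In an eigenbasis of [A], [\tr (A *m X)] is a sum of eigenvalues with nonnegative weights of
    total [\tr X]. *)
Lemma lambda_min_tr_le (R : realType) n (A X : 'M[R]_n) : A^T = A -> psd X ->
  lambda_min A * \tr X <= \tr (A *m X).
Proof.
move=> /real_spec [U [d [UU eA]]] pX.
have UtU := orthogonal_trmx UU.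
have dE l : eigenvalue A (d l).
  apply/eigenvalueP; exists (row l U^T).
    rewrite -row_mul eA /spec !mulmxA. rewrite UtU mul1mx row_mul.
    have -> : row l (diag_mx (\row_l0 d l0)) = d l *: delta_mx 0 l.
      by apply/rowP => j; rewrite !mxE eqxx eq_sym mulr_natr.
    by rewrite -scalemxAl -rowE.
  apply/eqP => P0; have := UtU => /(congr1 (row l)).
  rewrite row_mul P0 mul0mx => /rowP /(_ l); rewrite !mxE eqxx /=.
  by move/eqP; rewrite eq_sym oner_eq0.
(* [lambda_min] is an infimum, which lies below each [d l] only once the set of eigenvalues is
   bounded below. Every eigenvalue is some [d l]: an eigenvector has a nonzero coordinate in the
   basis [U]. *)
have lbE : has_lbound [set l | eigenvalue A l].
  exists (- \sum_l `|d l|) => x /= /eigenvalueP [v vA v0].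
  have /rowP vU : (v *m U) *m diag_mx (\row_l d l) = x *: (v *m U).
    by rewrite scalemxAl -vA eA /spec !mulmxA -(mulmxA _ _ U) UtU mulmx1.
  have [l vl] : exists l, (v *m U) 0 l != 0.
    apply/existsP; apply: contraT; rewrite negb_exists => /forallP vl.
    have vU0 : v *m U = 0.
      by apply/rowP => l; have := vl l; rewrite negbK [RHS]mxE => /eqP.
    by move: v0; rewrite -[v]mulmx1 -UU mulmxA vU0 mul0mx eqxx.
  have := vU l; rewrite mul_mx_diag mxE [(\row__ _) _ _]mxE [RHS]mxE mulrC.
  move=> /(mulIf vl) <-; rewrite lerNl (bigD1 l) //= -normrN.
  by apply: (le_trans (ler_norm _)); rewrite lerDl sumr_ge0.
have inf_le l : lambda_min A <= d l by apply: ge_inf => //=; exact: dE.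
rewrite [in leRHS]mxtrace_mulC [in leRHS]eA tr_mul_spec.
rewrite -[X in \tr X]mulmx1 -(spec1 UU) tr_mul_spec mulr_sumr.
apply: ler_sum => l _; rewrite mul1r ler_wpM2r //; exact: psd_conj_diag.
Qed.

(** * Matrix exponentials and Gibbs states *)

Lemma spec_exprn (R : realType) n (U : 'M[R]_n) d s : orthogonal U ->
  spec U d ^+ s = spec U (fun l => d l ^+ s).
Proof.
move=> UU; elim: s => [|s IH].
  by rewrite expr0 (_ : 1 = 1%:M) // -(spec1 UU); apply: eq_spec => l; rewrite expr0.
rewrite exprS IH -mulmxE specM //; apply: eq_spec => l; by rewrite exprS.
Qed.

(** Each entry of a partial sum of the matrix series is a fixed finite combination of partial sums
    of the scalar series at the [d l]. *)
Lemma expmx_spec (R : realType) n (U : 'M[R]_n) d : orthogonal U ->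
  expmx (spec U d) = spec U (fun l => expR (d l)).
Proof.
move=> UU; apply/matrixP => i j; rewrite mxE specE.
apply: cvg_lim => //.
have -> : series (fun s => (spec U d ^+ s) i j / s`!%:R) =
    fun m => \sum_l series (exp_coeff (d l)) m * (U i l * U j l).
  apply/funext => m; rewrite /series /=.
  under [RHS]eq_bigr do rewrite mulr_suml.
  rewrite exchange_big; apply: eq_bigr => s _ /=.
  rewrite spec_exprn // specE mulr_suml; apply: eq_bigr => l _.
  by rewrite /exp_coeff /= mulrAC.
apply: cvg_big => [|l _]; first exact: add_continuous.
by apply: cvgMr_tmp; exact: is_cvg_series_exp_coeff.
Qed.

(** With [sqr_overlap_sumr]: the squared overlaps of two orthonormal bases form a doubly stochastic
    matrix. *)
Lemma sqr_overlap_suml (R : realType) n (U V : 'M[R]_n) l :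
  orthogonal U -> orthogonal V -> \sum_j (U^T *m V) l j ^+ 2 = 1.
Proof.
move=> /orthogonal_trmx UU VV.
have : (U^T *m V *m (U^T *m V)^T) l l = 1.
  by rewrite trmx_mul trmxK mulmxA -(mulmxA _ V) VV mulmx1 UU mxE eqxx.
by rewrite mxE => <-; apply: eq_bigr => j _; rewrite [(_^T) _ _]mxE expr2.
Qed.

Lemma sqr_overlap_sumr (R : realType) n (U V : 'M[R]_n) j :
  orthogonal U -> orthogonal V -> \sum_l (U^T *m V) l j ^+ 2 = 1.
Proof.
move=> UU VV; rewrite -(sqr_overlap_suml j VV UU); apply: eq_bigr => l _.
by rewrite -[V^T *m U]trmxK trmx_mul trmxK [in RHS]mxE.
Qed.

Lemma mxtraceB (R : realType) n (A B : 'M[R]_n) :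
  \tr (A - B) = \tr A - \tr B.
Proof. by rewrite linearB. Qed.

(** Double stochasticity lets the unmixed terms [p l * p' l] and [q j * q' j] be spread over all
    pairs. The weights are nonnegative, so scalar inequalities in [l] and [j] lift to traces. *)
Lemma tr_mul_subspec (R : realType) n (U V : 'M[R]_n) p q p' q' :
  orthogonal U -> orthogonal V ->
  \tr ((spec U p - spec V q) *m (spec U p' - spec V q')) =
  \sum_l \sum_j (U^T *m V) l j ^+ 2 * ((p l - q j) * (p' l - q' j)).
Proof.
move=> UU VV; rewrite mulmxBl !mulmxBr !mxtraceB.
rewrite !specM // (mxtrace_mulC (spec V q)) !tr_spec_spec !tr_spec //.
have -> : \sum_l p l * p' l =
    \sum_l \sum_j (U^T *m V) l j ^+ 2 * (p l * p' l).
  by apply: eq_bigr => l _; rewrite -mulr_suml sqr_overlap_suml // mul1r.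
have -> : \sum_l q l * q' l =
    \sum_l \sum_j (U^T *m V) l j ^+ 2 * (q j * q' j).
  rewrite [RHS]exchange_big /=; apply: eq_bigr => l _.
  by rewrite -mulr_suml sqr_overlap_sumr // mul1r.
rewrite -!sumrB; apply: eq_bigr => l _.
by rewrite -!sumrB; apply: eq_bigr => j _; ring.
Qed.

(** * Entropy inequalities for Gibbs states *)

Lemma sub_mul_expR_ge (R : realType) (x y : R) :
  expR x - expR y <= (x - y) * expR x.
Proof.
have := expR_ge1Dx (y - x); rewrite expRD expRN => h.
have := expR_gt0 x => x0.
have : (1 + (y - x)) * expR x <= expR y / expR x * expR x by rewrite ler_pM2r.
rewrite divfK ?gt_eqF //; lra.
Qed.

(** For [y <= x], put [s = expR (x / 2)] and [t = expR (y / 2)]. The tangent bound gives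
    [2 (s - t) <= (x - y) s], and [s ^+ 2 - t ^+ 2 = (s - t) (s + t)]. Lifted to traces, this bounds
    a symmetrised relative entropy below by a distance of square roots. *)
Lemma sub_mul_sub_expR_ge (R : realType) (x y : R) :
  2 * (expR (x / 2) - expR (y / 2)) ^+ 2 <= (x - y) * (expR x - expR y).
Proof.
wlog xy : x y / y <= x => [h|].
  by have [|/ltW] := leP y x => /h //; rewrite -sqrrN opprB => /le_trans; apply; lra.
have e (z : R) : expR z = expR (z / 2) ^+ 2.
  by rewrite expr2 -expRD; congr expR; lra.
rewrite (e x) (e y); have := sub_mul_expR_ge (x / 2) (y / 2).
have := expR_gt0 (y / 2); have : expR (y / 2) <= expR (x / 2) by rewrite ler_expR; lra.
move: (expR (x / 2)) (expR (y / 2)) => s t ts t0 h.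
rewrite subr_sqr expr2.
have h1 : (s - t) * s <= (x / 2 - y / 2) * s * s by rewrite ler_wpM2r //; lra.
have h2 : 0 <= (s - t) * ((x - y) * t) by rewrite !mulr_ge0 // ?subr_ge0 //; lra.
have h3 : (s - t) * (s - t) <= (s - t) * ((x - y) * s).
  by rewrite ler_wpM2l ?subr_ge0 //; lra.
nra.
Qed.

(** Klein's inequality: [spec U a] and [spec V b] are the logarithms of two density matrices, and
    the tangent bound for the exponential is summed against the overlaps. *)
Lemma relative_entropy_ge0 (R : realType) n (U V : 'M[R]_n) a b :
  orthogonal U -> orthogonal V ->
  \sum_l expR (a l) = 1 -> \sum_l expR (b l) = 1 ->
  0 <= \tr ((spec U a - spec V b) *m spec U (fun l => expR (a l))).
Proof.
move=> UU VV a1 b1.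
(* A zero matrix written in the basis [V] brings the trace into the form of [tr_mul_subspec]. *)
have -> : spec U (fun l => expR (a l)) =
    spec U (fun l => expR (a l)) - spec V (fun=> 0).
  suff -> : spec V (fun=> 0) = 0 by rewrite subr0.
  by apply/matrixP => i j; rewrite specE mxE big1 // => l _; rewrite mul0r.
rewrite tr_mul_subspec //.
have e : \sum_l \sum_j (U^T *m V) l j ^+ 2 * (expR (a l) - expR (b j)) = 0.
  under eq_bigr do (under eq_bigr do rewrite mulrBr; rewrite sumrB).
  rewrite sumrB [X in _ - X]exchange_big /=.
  under eq_bigr do rewrite -mulr_suml sqr_overlap_suml // mul1r.
  under [X in _ - X]eq_bigr do rewrite -mulr_suml sqr_overlap_sumr // mul1r.
  by rewrite a1 b1 subrr.
rewrite -[leLHS]e; apply: ler_sum => l _; apply: ler_sum => j _.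
by rewrite ler_wpM2l ?sqr_ge0 // subr0 sub_mul_expR_ge.
Qed.

Definition contraction (R : realType) n (N : 'M[R]_n) : Prop :=
  forall u : 'cV[R]_n, \sum_i (N *m u) i 0 ^+ 2 <= \sum_i u i 0 ^+ 2.

Lemma tr_gram (R : realType) n (A : 'M[R]_n) :
  \tr (A^T *m A) = \sum_i \sum_j A j i ^+ 2.
Proof.
by apply: eq_bigr => i _; rewrite mxE; apply: eq_bigr => j _; rewrite mxE expr2.
Qed.

Lemma tr_gram_contraction (R : realType) n (N A : 'M[R]_n) : contraction N ->
  \tr ((N *m A)^T *m (N *m A)) <= \tr (A^T *m A).
Proof.
move=> cN; rewrite !tr_gram; apply: ler_sum => i _.
have := cN (col i A); rewrite [N *m _](_ : _ = col i (N *m A)); last first.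
  by apply/matrixP => j k; rewrite !mxE; apply: eq_bigr => l _; rewrite mxE.
by under eq_bigr do rewrite mxE; under [X in _ <= X]eq_bigr do rewrite mxE.
Qed.

(** Expansion of the squared Frobenius norm of [t *: X^T + Y]; the weight [t] stays free for later
    tuning. *)
Lemma tr_mul_amgm (R : realType) n (X Y : 'M[R]_n) t :
  - (2 * t * \tr (X *m Y)) <= t ^+ 2 * \tr (X *m X^T) + \tr (Y^T *m Y).
Proof.
have : 0 <= \tr ((t *: X^T + Y)^T *m (t *: X^T + Y)).
  by rewrite tr_gram; do 2 apply: sumr_ge0 => ? _; exact: sqr_ge0.
have -> : (t *: X^T + Y)^T = t *: X + Y^T by apply/matrixP => i j; rewrite !mxE.
rewrite mulmxDl !mulmxDr -!scalemxAl -!scalemxAr !mxtraceD !mxtraceZ.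
have -> : \tr (Y^T *m X^T) = \tr (X *m Y) by rewrite -trmx_mul mxtrace_tr.
lra.
Qed.

(* The symmetrised relative entropy of the two Gibbs states equals [delta / 2]
   times the left-hand side and, compared in the pair of eigenbases, is at least
   [2 |D|^2] for the difference [D] of their square roots; conversely [|D|]
   bounds the left-hand side because [N] is a contraction. *)
Lemma gibbs_stability (R : realType) n (U V N : 'M[R]_n) a b delta c :
  orthogonal U -> orthogonal V ->
  \sum_l expR (a l) = 1 -> \sum_l expR (b l) = 1 ->
  N^T = N -> contraction N -> 0 < delta ->
  spec U a - spec V b = (delta / 2) *: (1%:M - N) + c *: 1%:M ->
  \tr (N *m (spec V (fun l => expR (b l)) - spec U (fun l => expR (a l))))
    <= delta.
Proof.
move=> UU VV a1 b1 Ns cN d0 eAB.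
set P := spec U (fun l => expR (a l)); set Q := spec V (fun l => expR (b l)).
set T := \tr _.
have trP : \tr P = 1 := etrans (tr_spec _ UU) a1.
have trQ : \tr Q = 1 := etrans (tr_spec _ VV) b1.
pose SA := spec U (fun l => expR (a l / 2)).
pose SB := spec V (fun l => expR (b l / 2)).
have half (z : R) : expR (z / 2) * expR (z / 2) = expR z.
  by rewrite -expRD; congr expR; lra.
have PE : P = SA *m SA by rewrite specM //; apply: eq_spec => l; rewrite half.
have QE : Q = SB *m SB by rewrite specM //; apply: eq_spec => l; rewrite half.
pose D := SA - SB; pose S := SA + SB.
have Ds : D^T = D by rewrite /D linearB /= !spec_trmx.
have Ss : S^T = S by rewrite /S linearD /= !spec_trmx.
(* The multiple of the identity in [eAB], and the identity next to [N], drop out because [P] and [Q]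
   have equal traces. *)
have J : 2 * \tr (D *m D) <= delta / 2 * T.
  have -> : delta / 2 * T = \tr ((spec U a - spec V b) *m (P - Q)).
    rewrite eAB mulmxDl -!scalemxAl mul1mx mulmxBl mul1mx.
    rewrite mxtraceD !mxtraceZ !mxtraceB trP trQ subrr mulr0 addr0.
    by rewrite sub0r /T mulmxBr !mxtraceB mulmxBr mxtraceB opprB.
  have -> : \tr (D *m D) = _ := tr_mul_subspec _ _ _ _ UU VV.
  have -> : \tr ((spec U a - spec V b) *m (P - Q)) = _ :=
    tr_mul_subspec _ _ _ _ UU VV.
  rewrite mulr_sumr; apply: ler_sum => l _.
  rewrite mulr_sumr; apply: ler_sum => j _.
  rewrite mulrCA ler_wpM2l ?sqr_ge0 // -expr2; exact: sub_mul_sub_expR_ge.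
have DD0 : 0 <= \tr (D *m D).
  by rewrite -{1}Ds tr_gram; do 2 apply: sumr_ge0 => ? _; exact: sqr_ge0.
(* Parallelogram law: the squared norms of [S] and [D] add up to [2 * \tr (P + Q) = 4]. *)
have SS4 : \tr (S *m S) <= 4.
  suff : \tr (S *m S) + \tr (D *m D) = 4.
    by move: DD0; move: (\tr _) (\tr _) => x y; lra.
  rewrite -mxtraceD (_ : _ + _ = 2 *: (P + Q)); last first.
    rewrite /S /D !(mulmxDl, mulmxDr, mulmxN, mulNmx) opprK -PE -QE.
    by apply/matrixP => i j; rewrite !mxE; ring.
  by rewrite mxtraceZ mxtraceD trP trQ; ring.
have NS4 : \tr ((N *m S)^T *m (N *m S)) <= 4.
  by apply: le_trans (tr_gram_contraction _ cN) _; rewrite Ss.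
have SN4 : \tr ((S *m N)^T *m (S *m N)) <= 4.
  by move: NS4; rewrite !trmx_mul Ss Ns mxtrace_mulC.
(* With this weight, [J] bounds the term [t ^+ 2 * \tr (D *m D)] by exactly [t * T], half of the
   left side [2 * t * T]; what remains is [t * T <= 4 = t * delta]. *)
pose t := 4 / delta.
have t0 : 0 < t by rewrite divr_gt0.
have td : t * delta = 4 by rewrite /t divfK // gt_eqF.
(* The identity [D *m S + S *m D = 2 *: (P - Q)] replaces the difference of states by the difference
   [D] of their roots. *)
have TE : 2 * T = - (\tr (D *m (S *m N)) + \tr (D *m (N *m S))).
  have -> : \tr (D *m (S *m N)) = \tr (N *m (D *m S)).
    by rewrite mulmxA mxtrace_mulC.
  have -> : \tr (D *m (N *m S)) = \tr (N *m (S *m D)).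
    by rewrite mxtrace_mulC mulmxA.
  rewrite -linearD /= -mulmxDr.
  have -> : D *m S + S *m D = 2 *: (P - Q).
    rewrite /S /D PE QE !(mulmxDl, mulmxDr, mulmxN, mulNmx) scaler_nat mulr2n.
    by apply/matrixP => i j; rewrite !mxE; ring.
  by rewrite -scalemxAr mxtraceZ /T !mulmxBr !mxtraceB -mulrN opprB.
have := tr_mul_amgm D (S *m N) t; have := tr_mul_amgm D (N *m S) t.
rewrite Ds => h1 h2; clearbody T t.
have h3 : 2 * t * T <= t ^+ 2 * \tr (D *m D) + 4.
  have -> : 2 * t * T = t * (2 * T) by ring.
  rewrite TE; lra.
have h4 : t ^+ 2 * \tr (D *m D) <= t ^+ 2 * (delta / 4 * T).
  by rewrite ler_wpM2l ?sqr_ge0 //; lra.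
have h5 : t ^+ 2 * (delta / 4 * T) = t * T.
  by rewrite expr2 mulrA -(mulrA t) (mulrA t delta) td; field.
have : t * T <= t * delta by rewrite td; lra.
by rewrite ler_pM2l.
Qed.

(** * Hamiltonian updates and bisection *)

Lemma spec_shift (R : realType) n (U : 'M[R]_n) a c : orthogonal U ->
  spec U (fun l => a l - c) = spec U a - c *: 1%:M.
Proof.
move=> UU; transitivity (spec U a + spec U (fun=> - c * 1)).
  by rewrite specD; apply: eq_spec => l; rewrite mulr1.
by rewrite -specZ spec1 // scaleNr.
Qed.

Lemma sum_expR_gt0 (R : realType) n (a : 'I_n -> R) : (0 < n)%N ->
  0 < \sum_l expR (a l).
Proof.
case: n a => // n a _; rewrite (bigD1 ord0) //= ltr_pwDl ?expR_gt0 //.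
by apply: sumr_ge0 => l _; exact: expR_ge0.
Qed.

(** Dividing by the partition function [z] only shifts the Hamiltonian by [ln z], so the normalised
    state keeps an explicit logarithm. *)
Lemma gibbs_normalize (R : realType) n (U : 'M[R]_n) a : (0 < n)%N ->
  orthogonal U ->
  let z := \sum_l expR (a l) in
  \sum_l expR (a l - ln z) = 1 /\
  spec U (fun l => expR (a l - ln z)) = z^-1 *: spec U (fun l => expR (a l)).
Proof.
move=> n0 UU z; have z0 : 0 < z := sum_expR_gt0 a n0.
have e l : expR (a l - ln z) = z^-1 * expR (a l).
  by rewrite expRD expRN lnK ?posrE // mulrC.
split; last by rewrite specZ; exact: eq_spec.
by under eq_bigr do rewrite e; rewrite -mulr_sumr mulVf ?gt_eqF.
Qed.

(** Nonnegativity of the potential: the left side is a convex combination of the [a l], each of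
    which is at most the logarithm of the whole sum. *)
Lemma tr_mul_le_ln_tr_exp (R : realType) n (U X : 'M[R]_n) a :
  orthogonal U -> psd X -> \tr X = 1 ->
  \tr (X *m spec U a) <= ln (\sum_l expR (a l)).
Proof.
move=> UU pX X1; have UtU := orthogonal_trmx UU.
have x1 : \sum_l (U^T *m X *m U) l l = 1.
  by rewrite -[LHS]/(\tr _) mxtrace_mulC mulmxA UU mul1mx.
have al l : a l <= ln (\sum_l expR (a l)).
  have e0 : 0 < \sum_l expR (a l) by apply: sum_expR_gt0; exact: leq_trans (ltn_ord l).
  rewrite -[leLHS]expRK ler_ln ?posrE ?expR_gt0 // (bigD1 l) //= lerDl.
  by apply: sumr_ge0 => j _; exact: expR_ge0.
rewrite tr_mul_spec -[leRHS]mulr1 -x1 mulr_sumr; apply: ler_sum => l _.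
by rewrite ler_wpM2r //; exact: psd_conj_diag.
Qed.

(** Here [p], [q], [x] stand for the traces of the violated constraint against the new state, the
    old state and [X]. The violation [eps] loses [eps / 4] to stability, and
    [eps / 8 * (eps - eps / 4)] is [3 * eps ^+ 2 / 32]. *)
Lemma potential_drop_arith (R : realFieldType) (eps beta p q x y la lb : R) :
  0 < eps -> q - p <= eps / 4 ->
  0 <= eps / 4 / 2 * (1 - p) + (lb - la) * 1 -> x <= beta ->
  beta + eps < q ->
  la - (y + eps / 8 * (1 - x)) + 3 * eps ^+ 2 / 32 <= lb - y.
Proof.
move=> e0 qp kl xb bq.
have : eps / 8 * (q - p) <= eps / 8 * (eps / 4) by rewrite ler_wpM2l //; lra.
have : eps / 8 * (x + eps) <= eps / 8 * q by rewrite ler_wpM2l //; lra.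
lra.
Qed.

(** [b] is the Hamiltonian before the update and [a] the one after it; the increment is [eps / 4]
    times [(1 - N) / 2]. *)
Lemma HU_potential_step (R : realType) n (U V N X : 'M[R]_n) a b eps beta :
  (0 < n)%N -> orthogonal U -> orthogonal V -> N^T = N -> contraction N ->
  \tr X = 1 -> 0 < eps ->
  spec U a = spec V b + (eps / 8) *: (1%:M - N) ->
  \tr (N *m X) <= beta ->
  beta + eps < \tr (N *m ((\sum_l expR (b l))^-1 *: spec V (fun l => expR (b l)))) ->
  ln (\sum_l expR (a l)) - \tr (X *m spec U a) + 3 * eps ^+ 2 / 32 <=
  ln (\sum_l expR (b l)) - \tr (X *m spec V b).
Proof.
move=> n0 UU VV Ns cN X1 e0 eAB NX viol.
have [a1 Pa] := gibbs_normalize a n0 UU; have [b1 Pb] := gibbs_normalize b n0 VV.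
set za := \sum_l expR (a l) in a1 Pa *; set zb := \sum_l expR (b l) in b1 Pb viol *.
move: viol; rewrite -Pb => viol.
have eAB' : spec U (fun l => a l - ln za) - spec V (fun l => b l - ln zb) =
    (eps / 4 / 2) *: (1%:M - N) + (ln zb - ln za) *: 1%:M.
  rewrite !spec_shift // eAB; have -> : eps / 4 / 2 = eps / 8 by field.
  by rewrite scalerBl; apply/matrixP => i j; rewrite !mxE; ring.
have := relative_entropy_ge0 UU VV a1 b1.
have := gibbs_stability UU VV a1 b1 Ns cN (divr_gt0 e0 (ltr0n R 4)) eAB'.
rewrite eAB'; set P := spec U _; set Q := spec V _ in viol *.
have trP : \tr P = 1 := etrans (tr_spec _ UU) a1.
rewrite mulmxBr mulmxDl -!scalemxAl mul1mx mulmxBl mul1mx.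
rewrite mxtraceD !mxtraceZ !mxtraceB trP => stab kl.
have -> : \tr (X *m spec U a) = \tr (X *m spec V b) + eps / 8 * (1 - \tr (N *m X)).
  by rewrite eAB mulmxDr -scalemxAr mulmxBr mulmx1 mxtraceD mxtraceZ mxtraceB
    X1 (mxtrace_mulC X N).
exact: potential_drop_arith e0 stab kl NX viol.
Qed.

(** Each remaining round spends [3 * eps ^+ 2 / 32] of a potential that stays nonnegative. The
    eigenbasis is quantified in the induction because every update changes it. *)
Lemma HU_loop_exact (R : realType) n (J : finType) (A : J -> 'M[R]_n) b eps X
    fuel (U : 'M[R]_n) h H W :
  (0 < n)%N -> 0 < eps ->
  (forall j, (A j)^T = A j) -> (forall j, contraction (A j)) ->
  psd X -> \tr X = 1 -> (forall j, \tr (A j *m X) <= b j) ->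
  orthogonal U -> (eps / 4) *: H = spec U h -> W = spec U (fun l => expR (h l)) ->
  HU_loop A b eps fuel H W false ->
  fuel%:R * (3 * eps ^+ 2 / 32) <=
    ln (\sum_l expR (h l)) - \tr (X *m spec U h).
Proof.
move=> n0 e0 As cA pX X1 AX.
elim: fuel U h H W => [|fuel IH] U h H W UU eH eW /=.
  by rewrite mul0r subr_ge0 => _; exact: tr_mul_le_ln_tr_exp.
case=> [[]//|[j [viol]]].
set H' := H + _; have H's : ((eps / 4) *: H')^T = (eps / 4) *: H'.
  rewrite /H' scalerDr eH linearD /= spec_trmx; congr (_ + _).
  by apply/matrixP => x y; rewrite -[A j in RHS]As !mxE (eq_sym x).
have [V [h' [VV eH']]] := real_spec H's.
rewrite eH' expmx_spec // => /IH -/(_ V h' VV eH' erefl).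
rewrite -[fuel.+1%:R]natr1 [(_ + 1) * _]mulrDl mul1r => le1.
have eAB : spec V h' = spec U h + (eps / 8) *: (1%:M - A j).
  rewrite -eH' /H' scalerDr eH scalerA; congr (_ + _ *: _).
  by field.
rewrite eW tr_spec // in viol.
have := HU_potential_step n0 VV UU (As j) (cA j) X1 e0 eAB (AX j) viol.
lra.
Qed.

Lemma HU_loop_approx (R : realType) n (J : finType) (A : J -> 'M[R]_n) b eps
    fuel (U : 'M[R]_n) h H W :
  (0 < n)%N -> (forall j, (A j)^T = A j) ->
  orthogonal U -> (eps / 4) *: H = spec U h -> W = spec U (fun l => expR (h l)) ->
  HU_loop A b eps fuel H W true ->
  exists P, [/\ psd P, \tr P = 1 & forall j, \tr (A j *m P) <= b j + eps].
Proof.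
move=> n0 As; elim: fuel U h H W => [|fuel IH] U h H W UU eH eW //=.
case=> [[AP _]|[j [_]]].
  have [p1 eP] := gibbs_normalize h n0 UU.
  exists ((\tr W)^-1 *: W); rewrite eW tr_spec // -eP; split.
  - by apply: psd_spec => l; exact: expR_ge0.
  - by rewrite tr_spec.
  - by move=> j; have /negP := AP j; rewrite -leNgt eW tr_spec // -eP.
set H' := H + _; have H's : ((eps / 4) *: H')^T = (eps / 4) *: H'.
  rewrite /H' scalerDr eH linearD /= spec_trmx; congr (_ + _).
  by apply/matrixP => x y; rewrite -[A j in RHS]As !mxE (eq_sym x).
have [V [h' [VV eH']]] := real_spec H's.
by rewrite eH' expmx_spec // => /IH -/(_ V h' VV eH' erefl).
Qed.

Lemma le_ceil_nat (R : realType) (x : R) : x <= (ceil_nat x)%:R.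
Proof.
rewrite /ceil_nat; have := Num.Theory.ceil_ge x.
case: (Num.ceil x) => s //= /le_trans; apply.
by rewrite NegzE mulrNz oppr_le0 ler0z.
Qed.

Lemma HU_start (R : realType) n eps :
  [/\ orthogonal (1%:M : 'M[R]_n), (eps / 4) *: (0 : 'M[R]_n) = spec 1%:M (fun=> 0) &
      1%:M = spec (1%:M : 'M[R]_n) (fun=> expR 0)].
Proof.
have o : orthogonal (1%:M : 'M[R]_n) by rewrite /orthogonal trmx1 mulmx1.
split=> //; last by rewrite expR0 spec1.
apply/matrixP => i j; rewrite [RHS]specE big1 => [|l _]; last by rewrite mul0r.
by rewrite !mxE mulr0.
Qed.

(** The initial potential is [ln n], whereas the full number of rounds would spend at least
    [16 * 3 / 32 = 3 / 2] times [ln n]; this is a contradiction since [1 < n] makes [ln n]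
    positive. *)
Lemma HU_exact (R : realType) n (J : finType) (A : J -> 'M[R]_n) b eps X :
  (1 < n)%N -> 0 < eps ->
  (forall j, (A j)^T = A j) -> (forall j, contraction (A j)) ->
  psd X -> \tr X = 1 -> (forall j, \tr (A j *m X) <= b j) ->
  ~ HU A b eps false.
Proof.
move=> n1 e0 As cA pX X1 AX; have [orth1 H0 W0] := HU_start n eps.
move=> /(HU_loop_exact (ltnW n1) e0 As cA pX X1 AX orth1 H0 W0).
rewrite -H0 scaler0 mulmx0 linear0 subr0 expR0 sumr_const card_ord.
set T := ceil_nat _; have := le_ceil_nat (16 * ln n%:R / eps ^+ 2); rewrite -/T.
have ln0 : 0 < ln (n%:R : R) by rewrite ln_gt0 // ltr1n.
have e2 : 0 < eps ^+ 2 by rewrite exprn_gt0.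
rewrite ler_pdivrMr // => h1 h2.
have h3 : 16 * ln (n%:R : R) * (3 / 32) <= T%:R * (3 * eps ^+ 2 / 32) by lra.
have := le_trans h3 h2; lra.
Qed.

Lemma HU_approx (R : realType) n (J : finType) (A : J -> 'M[R]_n) b eps :
  (0 < n)%N -> (forall j, (A j)^T = A j) -> HU A b eps true ->
  exists P, [/\ psd P, \tr P = 1 & forall j, \tr (A j *m P) <= b j + eps].
Proof.
move=> n0 As; have [orth1 H0 W0] := HU_start n eps; exact: HU_loop_approx orth1 H0 W0.
Qed.

(** Each answer is used only as a one-sided certificate: [lo <= v <= hi + s] is invariant and the
    width halves in every round, whatever the pattern of answers. *)
Lemma BS_loop_bracket (R : realType) n (I : finType) (C : 'M[R]_n)
    (A : I -> 'M[R]_n) b eps v s rounds lo hi out :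
  (forall mid, HU (bs_mx C A) (bs_rhs b mid) eps false -> mid <= v) ->
  (forall mid, HU (bs_mx C A) (bs_rhs b mid) eps true -> v <= mid + s) ->
  lo <= v -> v <= hi + s ->
  BS_loop C A b eps rounds lo hi out ->
  out <= v <= out + (hi - lo) / 2 ^+ rounds + s.
Proof.
move=> HF HT; elim: rounds lo hi => [|rounds IH] lo hi /= l0 h0.
  by move=> ->; rewrite l0 expr0 divr1; lra.
have -> : (hi - lo) / 2 ^+ rounds.+1 = (hi - lo) / 2 / 2 ^+ rounds.
  by rewrite exprS invfM mulrA.
case=> -[] [hu].
  move=> /IH -/(_ l0 (HT _ hu)).
  by have -> : (lo + hi) / 2 - lo = (hi - lo) / 2 by field.
move=> /IH -/(_ (HF _ hu) h0).
by have -> : hi - (lo + hi) / 2 = (hi - lo) / 2 by field.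
Qed.

(** * Localizing and coefficient matrices *)

Lemma Ly_widen (R : realType) n (y : multinom n -> R) (p : mpoly n R) D :
  (msize p <= D)%N ->
  Ly y p = \sum_(e : bmultinom n D) mcoeff (bmnm e) p * y (bmnm e).
Proof.
move=> pD; pose I : subFinType _ := bmultinom n D.
rewrite /Ly (big_mksub I) ?msupp_uniq //=; last first.
  by move=> x /msize_mdeg_lt /leq_trans; apply.
by rewrite big_rmcond //= => j /memN_msupp_eq0 ->; rewrite mul0r.
Qed.

Lemma LyD (R : realType) n (y : multinom n -> R) (p q : mpoly n R) :
  Ly y (p + q) = Ly y p + Ly y q.
Proof.
pose D := maxn (msize (p + q)) (maxn (msize p) (msize q)).
rewrite !(@Ly_widen _ _ _ _ D) ?leq_max ?leqnn ?orbT // -big_split.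
by apply: eq_bigr => e _; rewrite mcoeffD mulrDl.
Qed.

Lemma LyZ (R : realType) n (y : multinom n -> R) c (p : mpoly n R) :
  Ly y (c *: p) = c * Ly y p.
Proof.
pose D := maxn (msize (c *: p)) (msize p).
rewrite !(@Ly_widen _ _ _ _ D) ?leq_max ?leqnn ?orbT // mulr_sumr.
by apply: eq_bigr => e _; rewrite mcoeffZ mulrA.
Qed.

Lemma Ly0 (R : realType) n (y : multinom n -> R) : Ly y 0 = 0.
Proof. by rewrite -(scale0r (0 : mpoly n R)) LyZ mul0r. Qed.

Lemma Ly_sum (R : realType) n (y : multinom n -> R) I r (P : pred I)
    (F : I -> mpoly n R) :
  Ly y (\sum_(i <- r | P i) F i) = \sum_(i <- r | P i) Ly y (F i).
Proof. exact: (big_morph _ (LyD y) (Ly0 y)). Qed.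

Lemma LyX (R : realType) n (y : multinom n -> R) e : Ly y (mpolyX R e) = y e.
Proof. by rewrite /Ly msuppX big_seq1 mcoeffX eqxx mul1r. Qed.

Lemma LyMX (R : realType) n (y : multinom n -> R) (p : mpoly n R) e :
  Ly y (p * mpolyX R e) =
  \sum_(z <- msupp p) mcoeff z p * y (mnm_add e z).
Proof.
rewrite [p in LHS]mpolyE mulr_suml Ly_sum; apply: eq_bigr => z _.
by rewrite -scalerAl -mpolyXD LyZ LyX addmC.
Qed.

Lemma mcoeffMX_sum (R : realType) n (p : mpoly n R) e z :
  mcoeff z (p * mpolyX R e) =
  \sum_(x <- msupp p) mcoeff x p * (mnm_add x e == z)%:R.
Proof.
rewrite [p in LHS]mpolyE mulr_suml linear_sum; apply: eq_bigr => x _.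
by rewrite -scalerAl -mpolyXD /= mcoeffZ mcoeffX.
Qed.

(** Exponents of degree above [t] contribute nothing because [pad] gives them the value 0, so Gram
    polynomials can be paired with [y] without a degree count. *)
Lemma Ly_pad (R : realType) n t (y : bmultinom n t.+1 -> R) (p : mpoly n R) :
  Ly (pad y) p = \sum_e mcoeff (bmnm e) p * y e.
Proof.
have yE e : pad y (bmnm e) = y e by rewrite /pad valK.
rewrite [p in LHS]mpolyE Ly_sum [p in RHS]mpolyE.
under [RHS]eq_bigr do rewrite linear_sum mulr_suml.
rewrite exchange_big; apply: eq_bigr => z _ /=; rewrite LyZ LyX.
under eq_bigr do rewrite mcoeffZ mcoeffX -mulrA.
rewrite -mulr_sumr; congr (_ * _); rewrite /pad.
case: insubP => [x _ xz|zt] /=.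
  rewrite (bigD1 x) //= -xz eqxx mul1r big1 ?addr0 // => x' xx'.
  by rewrite (inj_eq val_inj) eq_sym (negbTE xx') mul0r.
rewrite big1 // => x _; case: eqP => [zx|]; last by rewrite mul0r.
by move: zt; rewrite zx bmdeg.
Qed.

Definition vform (R : realType) n t (G : 'M[R]_(nmon n t)) : mpoly n R :=
  \sum_a \sum_b G a b *: mpolyX R (mnm_add (mon a) (mon b)).

Lemma vmon_form (R : realType) n t (G : 'M[R]_(nmon n t)) :
  ((vmon R n t)^T *m map_mx (@mpolyC n R) G *m vmon R n t) 0 0 = vform G.
Proof.
rewrite mxE /vform [RHS]exchange_big; apply: eq_bigr => b _ /=.
rewrite mxE mulr_suml; apply: eq_bigr => a _; rewrite !mxE.
by rewrite mulrC mulrA -mpolyXD mulrC mul_mpolyC addmC.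
Qed.

Lemma mulr_vform (R : realType) n t (G : 'M[R]_(nmon n t)) p :
  p * vform G = \sum_a \sum_b G a b *: (p * mpolyX R (mnm_add (mon a) (mon b))).
Proof.
rewrite mulr_sumr; apply: eq_bigr => a _; rewrite mulr_sumr; apply: eq_bigr => b _.
by rewrite scalerAr.
Qed.

Lemma locmxE (R : realType) n t p (y : multinom n -> R) a b :
  locmx t p y a b = Ly y (p * mpolyX R (mnm_add (mon a) (mon b))).
Proof. by rewrite mxE LyMX. Qed.

Lemma locmx_trmx (R : realType) n t p (y : multinom n -> R) :
  (locmx t p y)^T = locmx t p y.
Proof. by apply/matrixP => a b; rewrite mxE !locmxE (addmC (mon a)). Qed.

(** Adjointness of localizing and Gram matrices; [tr_coefmx] is its analogue with coefficient
    extraction in place of [Ly y]. *)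
Lemma tr_locmx (R : realType) n t p (y : multinom n -> R) G :
  \tr (locmx t p y *m G) = Ly y (p * vform G).
Proof.
rewrite mulr_vform Ly_sum; under [RHS]eq_bigr do rewrite Ly_sum.
rewrite [RHS]exchange_big; apply: eq_bigr => a _; rewrite mxE; apply: eq_bigr => b _ /=.
by rewrite LyZ locmxE mulrC (addmC (mon a)).
Qed.

(** One diagonal block of [Bgmx], with the degree bound as a parameter. *)
Definition coefmx (R : realType) n t d (p : mpoly n R) (e : multinom n) :
    'M[R]_(nmon n t) :=
  \sum_(z : bmultinom n d.+1 | lem (bmnm z) e)
    mcoeff (bmnm z) p *: Bmx R t (mnm_sub e (bmnm z)).

Lemma coefmxE (R : realType) n t d (p : mpoly n R) e a b :
  (msize p <= d.+1)%N ->
  coefmx t d p e a b = mcoeff e (p * mpolyX R (mnm_add (mon a) (mon b))).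
Proof.
move=> pd; rewrite /coefmx summxE big_mkcond /=.
rewrite [p in RHS](mpolywE pd) mulr_suml linear_sum; apply: eq_bigr => z _.
rewrite -scalerAl -mpolyXD /= mcoeffZ mcoeffX !mxE.
set x := mnm_add (mon a) (mon b); case: ifP => ze.
  congr (_ * _%:R); rewrite -{2}(submK ze) addmC.
  by rewrite (can_eq (addmK _)).
case: eqP => [xe|]; last by rewrite mulr0.
by move: ze; rewrite -xe lem_addr.
Qed.

Lemma tr_coefmx (R : realType) n t d (p : mpoly n R) e G :
  (msize p <= d.+1)%N ->
  \tr (coefmx t d p e *m G) = mcoeff e (p * vform G).
Proof.
move=> pd; rewrite mulr_vform linear_sum; under [RHS]eq_bigr do rewrite linear_sum.
rewrite [RHS]exchange_big; apply: eq_bigr => a _; rewrite mxE; apply: eq_bigr => b _ /=.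
by rewrite mcoeffZ coefmxE // mulrC (addmC (mon a)).
Qed.

Lemma coefmx_trmx (R : realType) n t d (p : mpoly n R) e :
  (msize p <= d.+1)%N -> (coefmx t d p e)^T = coefmx t d p e.
Proof.
by move=> pd; apply/matrixP => a b; rewrite mxE !coefmxE // (addmC (mon a)).
Qed.

Lemma mon_inj n t : injective (@mon n t).
Proof. by move=> a b /val_inj /enum_val_inj. Qed.

(** Within row [a], a monomial [x] of [p] meets at most one column, since [x + mon a + mon b = e]
    determines [b]. *)
Lemma coefmx_row_sum (R : realType) n t d (p : mpoly n R) e a :
  (msize p <= d.+1)%N -> \sum_b `|coefmx t d p e a b| <= l1norm p.
Proof.
move=> pd; pose F x (b : 'I_(nmon n t)) := mnm_add x (mnm_add (mon a) (mon b)) == e.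
apply: (@le_trans _ _ (\sum_b \sum_(x <- msupp p) `|mcoeff x p| * (F x b)%:R)).
  apply: ler_sum => b _; rewrite coefmxE // mcoeffMX_sum.
  apply: (le_trans (ler_norm_sum _ _ _)); apply: ler_sum => x _.
  by rewrite normrM [`|_%:R|]ger0_norm.
rewrite exchange_big; apply: ler_sum => x _ /=.
rewrite -mulr_sumr -[leRHS]mulr1 ler_wpM2l //.
case: (pickP (F x)) => [b Fb|F0]; last by rewrite big1 // => b _; rewrite F0.
rewrite (bigD1 b) //= big1 ?addr0 ?lern1 ?leq_b1 // => b' bb'.
case F' : (F x b') => //; move: bb'; apply: contraNeq => _.
have /addmI /addmI /mon_inj -> // := etrans (eqP F') (esym (eqP Fb)).
Qed.

(** * Operator norm bounds *)

Lemma sqr_sum_weighted_le (R : realType) (I : finType) (w u : I -> R) :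
  \sum_i `|w i| <= 1 -> (\sum_i w i * u i) ^+ 2 <= \sum_i `|w i| * u i ^+ 2.
Proof.
move=> w1; set s := \sum_i w i * u i; set q := \sum_i _ * _.
(* [2 s u - s^2 <= u^2] weighted by [|w|], with the sign of [w] moved to [u] *)
have : \sum_i (2 * s * (w i * u i) - `|w i| * s ^+ 2) <= q.
  apply: ler_sum => i _.
  have : 0 <= `|w i| * (s - Num.sg (w i) * u i) ^+ 2 by rewrite mulr_ge0 ?sqr_ge0.
  have -> : `|w i| * (s - Num.sg (w i) * u i) ^+ 2 =
     `|w i| * s ^+ 2 - 2 * s * (`|w i| * Num.sg (w i) * u i)
     + `|w i| * Num.sg (w i) ^+ 2 * u i ^+ 2 by ring.
  rewrite (mulrC `|w i| (Num.sg _)) -numEsg.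
  rewrite sqr_sg; have [->|wi] := eqVneq (w i) 0; first by rewrite normr0; lra.
  by rewrite mulr1; lra.
rewrite sumrB -mulr_sumr -mulr_suml -/s => h.
have : (\sum_i `|w i|) * s ^+ 2 <= 1 * s ^+ 2 by rewrite ler_wpM2r ?sqr_ge0.
by move: h; rewrite -mulrA -expr2; lra.
Qed.

(** Schur test: row sums control each squared coordinate, and symmetry makes the column sums equal
    to row sums. *)
Lemma schur_contraction (R : realType) n (A : 'M[R]_n) : A^T = A ->
  (forall i, \sum_j `|A i j| <= 1) -> contraction A.
Proof.
move=> As A1 u.
apply: (@le_trans _ _ (\sum_i \sum_j `|A i j| * u j 0 ^+ 2)).
  by apply: ler_sum => i _; rewrite mxE; exact: sqr_sum_weighted_le.
rewrite exchange_big; apply: ler_sum => j _ /=.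
rewrite -mulr_suml -[leRHS]mul1r ler_wpM2r ?sqr_ge0 //.
by rewrite (le_trans _ (A1 j)) // ler_sum // => i _; rewrite -{1}As mxE.
Qed.

Lemma big_tagnat (R : realType) m (p_ : 'I_m -> nat) (F : 'I_(\sum_i p_ i) -> R) :
  \sum_s F s = \sum_i \sum_j F (@tagnat.Rank _ p_ i j).
Proof.
rewrite sig_big_dep (reindex _ tagnat.sig_bij_on) /=; apply: eq_bigr => s _.
by congr F; rewrite -[LHS]tagnat.sig2K.
Qed.

Lemma contraction_mxdiag (R : realType) m (p_ : 'I_m -> nat)
    (B : forall i, 'M[R]_(p_ i)) :
  (forall i, contraction (B i)) -> contraction (mxdiag B).
Proof.
move=> cB u; rewrite !big_tagnat; apply: ler_sum => i _.
have /= := cB i (submxcol u i).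
suff -> : B i *m submxcol u i = submxcol (mxdiag B *m u) i.
  by under eq_bigr do rewrite mxE; under [X in _ <= X]eq_bigr do rewrite mxE.
by rewrite -{2}[u]submxcolK mul_mxdiag_mxcol mxcolK.
Qed.

Lemma contraction_slack (R : realType) n (A : 'M[R]_n) :
  contraction A -> contraction (slack A).
Proof.
move=> cA u; rewrite -[u]vsubmxK /slack mul_block_col !mul0mx !addr0.
rewrite !big_split_ord /= [X in _ + X <= _]big1 ?addr0 => [|i _]; last first.
  by rewrite col_mxEd mxE expr0n.
under eq_bigr do rewrite col_mxEu; under [X in _ <= X + _]eq_bigr do rewrite col_mxEu.
by rewrite (le_trans (cA _)) // lerDl sumr_ge0 // => i _; exact: sqr_ge0.
Qed.

Lemma contractionN (R : realType) n (A : 'M[R]_n) :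
  contraction A -> contraction (- A).
Proof.
move=> cA u; apply: le_trans (cA u); rewrite mulNmx.
by under eq_bigr do rewrite mxE sqrrN.
Qed.

(** * Moment sequences on a ball *)

Lemma sum_inj_le (R : realType) (I J : finType) (Q : pred I) (P : pred J)
    (F : I -> R) (G : J -> R) (h : I -> J) :
  (forall j, P j -> 0 <= G j) ->
  (forall i, Q i -> P (h i)) -> {in Q &, injective h} ->
  (forall i, Q i -> F i <= G (h i)) ->
  \sum_(i | Q i) F i <= \sum_(j | P j) G j.
Proof.
move=> G0 QP hI FG; apply: (@le_trans _ _ (\sum_(i in Q) G (h i))).
  by apply: ler_sum.
rewrite -(big_imset G hI) /= big_mkcond [leRHS]big_mkcond; apply: ler_sum => j _.
case: imsetP => [[i Qi ->]|_]; first by rewrite QP.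
by case: ifP => // /G0.
Qed.

(** Cauchy-Schwarz against the constant 1, from the nonnegative sum of the [(N * x j - S) ^+ 2]. *)
Lemma sqr_sum_le (R : realType) (J : finType) (P : pred J) (x : J -> R) :
  (\sum_(j | P j) x j) ^+ 2 <= (\sum_(j | P j) 1) * \sum_(j | P j) x j ^+ 2.
Proof.
set S := \sum_(j | P j) x j; set N := \sum_(j | P j) 1.
have [N0|N0] := eqVneq N 0.
  suff -> : S = 0 by rewrite N0 expr0n mul0r.
  rewrite /S big1 // => j Pj; move/eqP: N0; rewrite psumr_eq0 // => /allP /(_ j).
  by rewrite mem_index_enum Pj /= oner_eq0 => /(_ isT).
have Np : 0 < N by rewrite lt_neqAle eq_sym N0 sumr_ge0.
have : 0 <= \sum_(j | P j) (N * x j - S) ^+ 2 by apply: sumr_ge0 => j _; exact: sqr_ge0.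
have -> : \sum_(j | P j) (N * x j - S) ^+ 2 =
    N * (N * \sum_(j | P j) x j ^+ 2 - S ^+ 2).
  transitivity (\sum_(j | P j) (N ^+ 2 * x j ^+ 2 + (- (2 * N * S) * x j + S ^+ 2 * 1))).
    by apply: eq_bigr => j _; ring.
  rewrite !big_split /= -!mulr_sumr -/S -/N; ring.
by rewrite pmulr_rge0 // subr_ge0.
Qed.

(** The pairs and their reversals cover the square once, except that the diagonal is covered
    twice. *)
Lemma card_ordered_pairs (R : realType) s :
  \sum_(p : 'I_s * 'I_s | (p.1 <= p.2)%N) 1 = 1 / 2 * s%:R * (s%:R + 1) :> R.
Proof.
set c := \sum_(p | _) 1.
have c' : c = \sum_(p : 'I_s * 'I_s | (p.2 <= p.1)%N) 1.
  rewrite /c (reindex_inj (h := fun p : 'I_s * 'I_s => (p.2, p.1))) //.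
  by move=> [a b] [a' b'] [-> ->].
have : c + c = \sum_(a < s) \sum_(b < s) (1 + (a == b)%:R).
  rewrite {2}c' /c big_mkcond [X in _ + X]big_mkcond -big_split pair_bigA /=.
  apply: eq_bigr => -[a b] _ /=; rewrite -val_eqE /=.
  by case: ltngtP; rewrite ?addr0 ?add0r.
under eq_bigr => a _.
  rewrite big_split /= sumr_const card_ord (bigD1 a) //= eqxx big1 ?addr0; last first.
    by move=> b ba; rewrite eq_sym (negbTE ba).
  over.
rewrite sumr_const card_ord mulr1n -[_ *+ s]mulr_natl => e.
have -> : c = (c + c) / 2 by field.
by rewrite e; field.
Qed.

(** For nonnegative eigenvalues the sum of squares is at most the square of the sum. *)
Lemma psd_fro_le_sqr_tr (R : realType) n (M : 'M[R]_n) : psd M ->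
  \sum_i \sum_j M j i ^+ 2 <= (\tr M) ^+ 2.
Proof.
move=> pM; have [Ms _] := pM; have [U [d [UU eM]]] := real_spec Ms.
have d0 l : 0 <= d l by apply: psd_spec_ge0 UU _; rewrite -eM.
rewrite -tr_gram Ms eM specM // !tr_spec // expr2 mulr_suml.
apply: ler_sum => l _; rewrite ler_wpM2l // (bigD1 l) //= lerDl.
by rewrite sumr_ge0.
Qed.

Lemma mdeg_le_exists n (e : multinom n) j : (j <= mdeg e)%N ->
  exists a, lem a e /\ mdeg a = j.
Proof.
elim: j => [|j IH] je.
  by exists mnm0; split; [apply/mnm_lepP => i; rewrite mnmE | rewrite mdeg0].
have [a [ae aj]] := IH (ltnW je).
have [i ai] : exists i, (a i < e i)%N.
  apply/existsP; apply: contraT; rewrite negb_exists => /forallP ge.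
  move: je; rewrite -aj ltnNge !mdegE leq_sum // => i _.
  by have := ge i; rewrite -leqNgt.
exists (mnm_add a (mnm1 i)); split; last by rewrite mdegD mdeg1 aj addn1.
apply/mnm_lepP => i'; rewrite mnmDE mnm1E; case: eqVneq => [<-|_].
  by rewrite addn1.
by rewrite addn0; apply/mnm_lepP: i'.
Qed.

Lemma mon_surj n t (e : multinom n) : (mdeg e <= t)%N ->
  exists a : 'I_(nmon n t), mon a = e.
Proof.
by move=> et; exists (enum_rank (@BMultinom n t.+1 e et)); rewrite /mon enum_rankK.
Qed.

(** A divisor of [e] of degree [minn (mdeg e) k] leaves a cofactor of degree at most [k]; swapping
    the two puts the entry on or above the diagonal. *)
Lemma mon_add_surj n k (e : multinom n) : (mdeg e <= 2 * k)%N ->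
  exists p : 'I_(nmon n k) * 'I_(nmon n k),
    (p.1 <= p.2)%N /\ mnm_add (mon p.1) (mon p.2) = e.
Proof.
move=> ek; have [a [ae aj]] := mdeg_le_exists (geq_minl (mdeg e) k).
have [|i mi] := @mon_surj n k a; first by rewrite aj geq_minr.
have [|j mj] := @mon_surj n k (mnm_sub e a).
  have := congr1 mdeg (submK ae); rewrite mdegD aj => h.
  by rewrite -(leq_add2r (minn (mdeg e) k)) h; lia.
have ije : mnm_add (mon i) (mon j) = e by rewrite mi mj addmC submK.
have [ij|/ltnW ji] := leqP i j; first by exists (i, j).
by exists (j, i); rewrite addmC.
Qed.

(** Distinct moments occupy distinct entries of the upper triangle. Cauchy-Schwarz over its
    [s (s + 1) / 2] entries leaves the Frobenius norm, which the trace dominates. *)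
Lemma sum_abs_moments_le (R : realType) n k (y : multinom n -> R) :
  psd (momentmx k y) ->
  \sum_(e : bmultinom n (2 * k).+1) `|y (bmnm e)| <=
    \tr (momentmx k y) * Num.sqrt (1 / 2 * (nmon n k)%:R * ((nmon n k)%:R + 1)).
Proof.
move=> pM; set M := momentmx k y in pM *; set s := nmon n k.
have tr0 : 0 <= \tr M by rewrite -[M]mulmx1 -(@spec1 _ _ 1%:M) ?psd_tr_mul_ge0 //;
  [apply: psd_spec => _ | rewrite /orthogonal trmx1 mulmx1].
have /choice [h hP] : forall e : bmultinom n (2 * k).+1, exists p : 'I_s * 'I_s,
    (p.1 <= p.2)%N /\ mnm_add (mon p.1) (mon p.2) = bmnm e.
  by move=> e; apply: mon_add_surj; rewrite -ltnS bmdeg.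
pose S := \sum_(p : 'I_s * 'I_s | (p.1 <= p.2)%N) `|M p.1 p.2|.
apply: (@le_trans _ _ S).
  apply: (@sum_inj_le _ _ _ _ _ _ _ h) => //.
  - by move=> e _; case: (hP e).
  - move=> e e' _ _ ee; apply: val_inj; rewrite /= -(proj2 (hP e)) ee.
    exact: (proj2 (hP e')).
  - by move=> e _; rewrite mxE (proj2 (hP e)).
have S0 : 0 <= S by apply: sumr_ge0.
have c0 : 0 <= 1 / 2 * s%:R * (s%:R + 1) :> R by rewrite !mulr_ge0 ?addr_ge0 ?ler0n.
rewrite -(@ler_pXn2r _ 2) ?nnegrE ?mulr_ge0 ?sqrtr_ge0 // exprMn sqr_sqrtr //.
apply: le_trans (sqr_sum_le _ _) _; rewrite card_ordered_pairs mulrC ler_wpM2r //.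
apply: le_trans (psd_fro_le_sqr_tr pM); rewrite exchange_big pair_bigA /=.
rewrite big_mkcond; apply: ler_sum => -[a b] _ /=.
by case: ifP => _; rewrite ?sqr_ge0 // real_normK ?num_real.
Qed.

(** Reading off coordinates injects the exponents into the tuples of sum at most [k], which
    [card_partial_ord_partitions] counts. *)
Lemma nmon_le (n k : nat) : (nmon n k <= 'C(n + k, n))%N.
Proof.
rewrite -card_partial_ord_partitions /nmon.
pose h (e : bmultinom n k.+1) : n.-tuple 'I_k.+1 := [tuple inord (bmnm e i) | i < n].
have hE (e : bmultinom n k.+1) i : tnth (h e) i = bmnm e i :> nat.
  rewrite tnth_mktuple inordK // (leq_ltn_trans _ (bmdeg e)) // mdegE.
  by rewrite (bigD1 i) //= leq_addr.
have hI : injective h.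
  move=> e e' ee; apply: val_inj; apply/mnmP => i /=.
  by rewrite -!hE ee.
rewrite -(card_imset _ hI) subset_leq_card //.
apply/fintype.subsetP => t /imsetP [e _ ->].
rewrite inE big_tuple; under eq_bigr do rewrite hE.
by rewrite -mdegE -ltnS bmdeg.
Qed.

Lemma ball_poly_mulX (R : realType) n (c r : R) e :
  ball_poly n c r * mpolyX R e =
  c *: (r *: mpolyX R e - \sum_(i < n) mpolyX R (mnm_add (mnm_add (mnm1 i) (mnm1 i)) e)).
Proof.
rewrite /ball_poly -mulrA mul_mpolyC mulrBl mul_mpolyC mulr_suml.
by congr (_ *: (_ - _)); apply: eq_bigr => i _; rewrite expr2 -!mpolyXD.
Qed.

Lemma halfdeg_ball_poly (R : realType) n (c r : R) :
  (halfdeg (ball_poly n c r) <= 1)%N.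
Proof.
suff : (msize (ball_poly n c r) <= 3)%N by rewrite /halfdeg; lia.
rewrite msizeE; apply/bigmax_leqP_seq => e; rewrite mcoeff_msupp => + _.
apply: contraNT; rewrite -leqNgt => e3.
rewrite -[ball_poly n c r]mulr1 -(mpolyX0 n R) ball_poly_mulX.
rewrite mcoeffZ mcoeffB mcoeffZ mcoeffX linear_sum /= big1 ?subr0.
  have [e0|_] := eqVneq mnm0 e; last by rewrite !mulr0.
  by move: e3; rewrite -e0 mdeg0.
move=> i _; rewrite mcoeffX addm0; case: eqP => [ee|//].
by move: e3; rewrite -ee mdegD !mdeg1.
Qed.

Lemma psd_diag_ge0 (R : realType) n (M : 'M[R]_n) i : psd M -> 0 <= M i i.
Proof.
by move=> pM; have := psd_conj_diag 1%:M i pM; rewrite trmx1 mul1mx mulmx1.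
Qed.

(** [T j] collects the diagonal moments of degree [2 * j]. The diagonal of the localizing matrix
    yields [Fstep]; summed over a degree it gives [T j.+1 <= r * T j], and the trace is bounded by a
    geometric sum. *)
Lemma tr_momentmx_le (R : realType) n k (c r : R) (y : multinom n -> R) :
  0 < r < 1 -> 0 < c -> y mnm0 = 1 -> psd (momentmx k y) ->
  psd (locmx (k - halfdeg (ball_poly n c r)) (ball_poly n c r) y) ->
  \tr (momentmx k y) <= 1 / (1 - r).
Proof.
move=> /andP [r0 r1] c0 y0 pM pL.
pose F (e : multinom n) := y (mnm_add e e).
have F0 e : (mdeg e <= k)%N -> 0 <= F e.
  by move=> /mon_surj [a <-]; have := psd_diag_ge0 a pM; rewrite mxE.
have Fstep e : (mdeg e < k)%N -> \sum_(i < n) F (mnm_add e (mnm1 i)) <= r * F e.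
  move=> ek.
  (* The ball polynomial has half-degree at most 1, so every exponent of degree below [k] indexes a
     row of its localizing matrix. *)
  have [a ea] : exists a : 'I_(nmon n (k - halfdeg (ball_poly n c r))), mon a = e.
    by apply: mon_surj; have := halfdeg_ball_poly n c r; lia.
  have := psd_diag_ge0 a pL; rewrite locmxE ball_poly_mulX LyZ pmulr_rge0 //.
  rewrite -scaleN1r LyD !LyZ Ly_sum LyX ea mulN1r subr_ge0; congr (_ <= _).
  apply: eq_bigr => i _; rewrite LyX /F; congr y.
  by apply/mnmP => j; rewrite !mnmDE; lia.
pose T j := \sum_(e : bmultinom n k.+1 | mdeg (bmnm e) == j) F (bmnm e).
have T0 : T 0%N = 1.
  have z0 : (mdeg (mnm0 : multinom n) < k.+1)%N by rewrite mdeg0.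
  pose z := BMultinom z0.
  rewrite /T (big_pred1 z) => [|e]; first by rewrite /F /= addm0.
  by rewrite /= mdeg_eq0 -(inj_eq val_inj).
have TS j : (j < k)%N -> T j.+1 <= r * T j.
  move=> jk; rewrite /T mulr_sumr.
  apply: (@le_trans _ _ (\sum_(e : bmultinom n k.+1 | mdeg (bmnm e) == j)
    \sum_(i < n) F (mnm_add (bmnm e) (mnm1 i)))); last first.
    by apply: ler_sum => e /eqP ej; apply: Fstep; rewrite ej.
  rewrite pair_big_dep /=.
  have G0 (p : bmultinom n k.+1 * 'I_n) : (mdeg (bmnm p.1) == j) && true ->
      0 <= F (mnm_add (bmnm p.1) (mnm1 p.2)).
    by rewrite andbT => /eqP pj; apply: F0; rewrite mdegD mdeg1 pj addn1.
  have dec (e : bmultinom n k.+1) : mdeg (bmnm e) == j.+1 ->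
      exists p : bmultinom n k.+1 * 'I_n,
        mdeg (bmnm p.1) == j /\ mnm_add (bmnm p.1) (mnm1 p.2) = bmnm e.
    move=> /eqP ej; have [i ei] : exists i, bmnm e i != 0%N.
      apply/existsP; apply: contra_eqT ej; rewrite negb_exists => /forallP e0.
      by rewrite mdegE big1 // => i _; apply/eqP; rewrite -[_ == _]negbK.
    rewrite -lep1mP in ei; have := congr1 mdeg (submK ei).
    rewrite mdegD mdeg1 ej addn1 => -[bj].
    have bk : (mdeg (mnm_sub (bmnm e) (mnm1 i)) < k.+1)%N by rewrite bj ltnW.
    by exists (BMultinom bk, i); rewrite /= bj submK.
  (* Either there is no exponent of degree [j.+1], as for [n = 0], and the sum is empty, or a
     decomposition [p0] is available as the default value for the choice function. *)
  have [e0 ej0|none] := pickP (fun e : bmultinom n k.+1 => mdeg (bmnm e) == j.+1);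
    last by rewrite big_pred0 // sumr_ge0.
  have [p0 _] := dec e0 ej0.
  have /choice [h hP] : forall e : bmultinom n k.+1,
      exists p : bmultinom n k.+1 * 'I_n, mdeg (bmnm e) == j.+1 ->
        mdeg (bmnm p.1) == j /\ mnm_add (bmnm p.1) (mnm1 p.2) = bmnm e.
    move=> e; case: (boolP (mdeg (bmnm e) == j.+1)) => [/dec [p hp]|_].
      by exists p.
    by exists p0.
  apply: (@sum_inj_le _ _ _ _ _ _ _ h) => //.
  - by move=> e /hP [-> _].
  - move=> e e' /hP [_ he] /hP [_ he'] ee; apply: val_inj.
    by rewrite /= -he -he' ee.
  - by move=> e /hP [_ ->].
have Tr j : (j <= k)%N -> T j <= r ^+ j.
  elim: j => [|j IH] jk; first by rewrite T0 expr0.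
  rewrite (le_trans (TS j jk)) // exprS ler_wpM2l ?(ltW r0) //.
  exact: IH (ltnW jk).
have -> : \tr (momentmx k y) = \sum_(j < k.+1) T j.
  rewrite /mxtrace; under eq_bigr do rewrite mxE.
  transitivity (\sum_(e : bmultinom n k.+1) F (bmnm e)).
    by rewrite [RHS](reindex _ (onW_bij _ (@enum_val_bij (bmultinom n k.+1)))).
  by rewrite (partition_big (fun e : bmultinom n k.+1 => Ordinal (bmdeg e)) xpredT).
apply: (@le_trans _ _ (\sum_(j < k.+1) r ^+ j)).
  by apply: ler_sum => j _; apply: Tr; rewrite -ltnS.
have := subrX1 r k.+1; rewrite ler_pdivlMr ?subr_gt0 // => e.
have : 0 <= r ^+ k.+1 by rewrite exprn_ge0 // ltW.
by move: e; move: (\sum_(_ < _) _) (r ^+ _) => S P; lra.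
Qed.

(** * Certificates and measures *)

Lemma psd_congr (R : realType) m n (M : 'M[R]_n) (P : 'M[R]_(m, n)) :
  psd M -> psd (P *m M *m P^T).
Proof.
move=> [Ms M0]; split=> [|u]; first by rewrite !trmx_mul trmxK Ms mulmxA.
by have := M0 (P^T *m u); rewrite trmx_mul trmxK !mulmxA.
Qed.

Lemma psd_mxsub (R : realType) m n (M : 'M[R]_n) (f : 'I_m -> 'I_n) :
  psd M -> psd (mxsub f f M).
Proof.
move=> /(psd_congr (rowsub f 1%:M)); congr psd.
apply/matrixP => i j; rewrite mul_rowsub_mx mul1mx mxE.
under eq_bigr do rewrite !mxE.
rewrite (bigD1 (f j)) //= eqxx mulr1 big1 ?addr0 ?mxE // => l lj.
by rewrite eq_sym (negbTE lj) mulr0.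
Qed.

Lemma psd_ulsubmx (R : realType) n (M : 'M[R]_(n + 1)) :
  psd M -> psd (ulsubmx M).
Proof.
move=> /(psd_mxsub (lshift 1)); congr psd.
by apply/matrixP => i j; rewrite !mxE.
Qed.

Lemma psd_block_diag (R : realType) n (M : 'M[R]_n) c :
  psd M -> 0 <= c -> psd (block_mx M 0 0 (c%:M : 'M[R]_1)).
Proof.
move=> [Ms M0] c0; split=> [|u].
  by rewrite tr_block_mx Ms !trmx0 tr_scalar_mx.
rewrite -[u]vsubmxK tr_col_mx mul_row_block mul_row_col !mulmx0 addr0 add0r.
rewrite mxE addr_ge0 //.
rewrite mul_mx_scalar -scalemxAl mxE mulr_ge0 // mxE big_ord1 mxE.
by rewrite -expr2 sqr_ge0.
Qed.

Lemma tr_slack_mul (R : realType) n (A : 'M[R]_n) (P : 'M[R]_(n + 1)) :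
  \tr (slack A *m P) = \tr (A *m ulsubmx P).
Proof.
rewrite -{1}[P]submxK /slack mulmx_block !mul0mx !addr0 mxtrace_block.
by rewrite linear0 addr0.
Qed.

Lemma tr_mxdiag_mul (R : realType) m (p_ : 'I_m -> nat)
    (B : forall i, 'M[R]_(p_ i)) (M : 'M[R]_(\sum_i p_ i)) :
  \tr (mxdiag B *m M) = \sum_i \tr (B i *m submxblock M i i).
Proof. by rewrite -{1}[M]submxblockK mul_mxdiag_mxblock mxtrace_mxblock. Qed.

(** Only diagonal blocks are read, so it applies to an arbitrary matrix [M], in particular to the
    output of HU without any block structure being established. *)
Definition gram_poly (R : realType) n m (g : 'I_m.+1 -> mpoly n R) k
    (M : 'M[R]_(\sum_i blk g k i)) : mpoly n R :=
  \sum_i g i * vform (submxblock M i i).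

Lemma msize_halfdeg (R : realType) n (p : mpoly n R) :
  (msize p <= (2 * halfdeg p).+1)%N.
Proof. rewrite /halfdeg; lia. Qed.

Lemma tr_momdiag (R : realType) n m (g : 'I_m.+1 -> mpoly n R) k y M :
  \tr (momdiag g k y *m M) = Ly y (gram_poly M).
Proof.
by rewrite tr_mxdiag_mul Ly_sum; apply: eq_bigr => i _; rewrite tr_locmx.
Qed.

Lemma BgmxE (R : realType) n m (g : 'I_m.+1 -> mpoly n R) k e :
  Bgmx g k e =
    mxdiag (fun i => coefmx (k - halfdeg (g i)) (2 * halfdeg (g i)) (g i) e).
Proof. by []. Qed.

(** The constraints of CON thus compare the coefficients of a Gram polynomial with those of [f]. *)
Lemma tr_Bgmx (R : realType) n m (g : 'I_m.+1 -> mpoly n R) k e M :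
  \tr (Bgmx g k e *m M) = mcoeff e (gram_poly M).
Proof.
rewrite BgmxE tr_mxdiag_mul linear_sum; apply: eq_bigr => i _ /=.
by rewrite tr_coefmx // msize_halfdeg.
Qed.

Lemma Bgmx_trmx (R : realType) n m (g : 'I_m.+1 -> mpoly n R) k e :
  (Bgmx g k e)^T = Bgmx g k e.
Proof.
rewrite BgmxE tr_mxdiag; apply/eq_mxdiagP => i.
by rewrite coefmx_trmx // msize_halfdeg.
Qed.

Lemma momdiag_trmx (R : realType) n m (g : 'I_m.+1 -> mpoly n R) k y :
  (momdiag g k y)^T = momdiag g k y.
Proof. by rewrite tr_mxdiag; apply/eq_mxdiagP => i; rewrite locmx_trmx. Qed.

Lemma contraction_Bgmx (R : realType) n m (g : 'I_m.+1 -> mpoly n R) k e :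
  (forall i, l1norm (g i) <= 1) -> contraction (Bgmx g k e).
Proof.
move=> g1; rewrite BgmxE; apply: contraction_mxdiag => i.
have gd := msize_halfdeg (g i).
apply: schur_contraction => [|a]; first exact: coefmx_trmx.
apply: le_trans (g1 i); exact: coefmx_row_sum.
Qed.

Lemma slack_trmx (R : realType) n (A : 'M[R]_n) : A^T = A -> (slack A)^T = slack A.
Proof. by move=> As; rewrite /slack tr_block_mx As !trmx0. Qed.

Lemma sos_feasible_gram (R : realType) n m (f : mpoly n R) g k l
    (G : forall i : 'I_m.+1, 'M[R]_(blk g k i)) :
  sos_feasible f g k l G ->
  psd (mxdiag G) /\ f - mpolyC n l = gram_poly (mxdiag G).
Proof.
move=> [pG ->]; split=> //; apply: eq_bigr => i _.
by rewrite vmon_form submxblock_diag.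
Qed.

Lemma evalp_vform_ge0 (R : realType) n t (G : 'M[R]_(nmon n t)) x :
  psd G -> 0 <= evalp (vform G) x.
Proof.
move=> [_ /(_ (\col_a evalp (mpolyX R (mon a)) x))]; congr (_ <= _).
rewrite mxE /evalp [RHS]raddf_sum /=; under [RHS]eq_bigr do rewrite raddf_sum /=.
rewrite [RHS]exchange_big; apply: eq_bigr => b _ /=.
rewrite [(_ *m _) 0 b]mxE mulr_suml; apply: eq_bigr => a _.
by rewrite !mxE /evalp mevalZ mpolyXD mevalM; ring.
Qed.

(** A Gram polynomial is nonnegative on [Sset g]. This validates the initial lower end
    [f0 - evalp f a] of the bisection. *)
Lemma sos_le_evalp (R : realType) n m (f : mpoly n R) g k l
    (G : forall i : 'I_m.+1, 'M[R]_(blk g k i)) a :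
  g ord0 = 1 -> sos_feasible f g k l G -> Sset g a -> l <= evalp f a.
Proof.
move=> g0 /sos_feasible_gram [pG fE] ha.
have : 0 <= evalp (f - mpolyC n l) a; last by rewrite /evalp mevalB mevalC subr_ge0.
rewrite fE /evalp /gram_poly linear_sum /= sumr_ge0 // => i _.
rewrite mevalM mulr_ge0 //; last by apply: evalp_vform_ge0; exact: psd_mxsub.
have [->|i0] := eqVneq i ord0; first by rewrite g0 meval1.
by apply: ha; rewrite lt0n.
Qed.

(** Integrability and value go through the induction together, since additivity of the integral
    requires integrable terms. *)
Lemma Rintegral_lincomb (R : realType) n
    (mu : {measure set (n.-tuple R) -> \bar R}) (c : multinom n -> R) r :
  finite_moments mu ->
  mu.-integrable setT (EFin \o (fun x => \sum_(e <- r) c e * evalmon e x)) /\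
  Rintegral mu setT (fun x => \sum_(e <- r) c e * evalmon e x) =
    \sum_(e <- r) c e * moments mu e.
Proof.
move=> mufin; elim: r => [|e r [IH1 IH2]].
  rewrite big_nil (_ : (fun x => _) = cst 0); last by apply/funext => x; rewrite big_nil.
  by split; [exact: integrable0 | rewrite Rintegral_cst // mul0r].
rewrite big_cons -IH2.
rewrite (_ : (fun x => _) = fun x => c e * evalmon e x +
    \sum_(e0 <- r) c e0 * evalmon e0 x); last by apply/funext => x; rewrite big_cons.
have ie : mu.-integrable setT (EFin \o (fun x => c e * evalmon e x)).
  by have := integrableZl measurableT (c e) (mufin e).
split; first exact: (integrableD measurableT ie IH1).
by rewrite RintegralD // RintegralZl //; exact: mufin.
Qed.

Lemma Rintegral_evalp (R : realType) n
    (mu : {measure set (n.-tuple R) -> \bar R}) (p : mpoly n R) :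
  finite_moments mu -> Rintegral mu setT (evalp p) = Ly (moments mu) p.
Proof.
move=> mufin; rewrite /Ly.
rewrite -(proj2 (Rintegral_lincomb (fun e => mcoeff e p) (msupp p) mufin)).
by congr Rintegral.
Qed.

Lemma moments0_ge0 (R : realType) n (mu : {measure set (n.-tuple R) -> \bar R}) :
  0 <= moments mu mnm0.
Proof.
apply: Rintegral_ge0 => x _; rewrite /evalmon /mmap1 prodr_ge0 // => i _.
by rewrite mnmE expr0.
Qed.

(** The number of rounds dominates the base-2 logarithm of [w / eps], also when that is negative and
    no round takes place. *)
Lemma bisection_width (R : realType) (w eps : R) : 0 < eps -> 0 < w ->
  w / 2 ^+ ceil_nat (ln (w / eps) / ln 2) <= eps.
Proof.
move=> e0 w0; set T := ceil_nat _.
have := le_ceil_nat (ln (w / eps) / ln 2); rewrite -/T.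
have ln2 : 0 < ln (2 : R) by rewrite ln_gt0 // ltr1n.
rewrite ler_pdivrMr // => h.
have : w / eps <= 2 ^+ T.
  have -> : 2 ^+ T = expR (T%:R * ln 2) :> R by rewrite expRM_natl lnK ?posrE.
  by rewrite -[leLHS]lnK ?posrE ?divr_gt0 // ler_expR.
by rewrite ler_pdivrMr // => h'; rewrite ler_pdivrMr ?exprn_gt0 // mulrC.
Qed.

Lemma bs_mx_trmx (R : realType) N (I : finType) (C : 'M[R]_N) A (j : I + I + unit) :
  C^T = C -> (forall i, (A i)^T = A i) -> (bs_mx C A j)^T = bs_mx C A j.
Proof. by move=> Cs As; case: j => [[i|i]|[]] //=; rewrite linearN /= As. Qed.

Lemma bs_mx_contraction (R : realType) N (I : finType) (C : 'M[R]_N) A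
    (j : I + I + unit) :
  contraction C -> (forall i, contraction (A i)) -> contraction (bs_mx C A j).
Proof. by move=> cC cA; case: j => [[i|i]|[]] //=; exact: contractionN. Qed.

(** * What the two answers of HU certify inside CON *)

Definition con_HU (R : realType) n m (f : mpoly n R) (g : 'I_m.+1 -> mpoly n R)
    (k : nat) (eps mid : R) (eta : bool) : Prop :=
  HU (bs_mx (slack (Bgmx g k mnm0))
            (fun e : nzmon n k => slack (Bgmx g k (bmnm (val e)))))
     (bs_rhs (fun e : nzmon n k => mcoeff (bmnm (val e)) f) mid) eps eta.

(** The smallest eigenvalue times the trace of the Gram matrix is at most the integral of [f - l],
    hence at most that of [f - lam] because the mass is nonnegative, hence at most the smallest
    eigenvalue. *)
Lemma sos_tr_le1 (R : realType) n m k (f : mpoly n R) (g : 'I_m.+1 -> mpoly n R)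
    (mu : {measure set (n.-tuple R) -> \bar R}) l lam
    (G : forall i : 'I_m.+1, 'M[R]_(blk g k i)) :
  finite_moments mu -> 0 < lambda_min (momdiag g k (moments mu)) ->
  Rintegral mu setT (fun x => evalp f x - lam) /
    lambda_min (momdiag g k (moments mu)) <= 1 ->
  lam <= l -> sos_feasible f g k l G -> \tr (mxdiag G) <= 1.
Proof.
move=> mufin lm0 + laml /sos_feasible_gram [pG fE].
rewrite ler_pdivrMr // mul1r => le_lm.
rewrite -(ler_pM2l lm0) mulr1; apply: le_trans le_lm.
apply: le_trans (lambda_min_tr_le (momdiag_trmx g k (moments mu)) pG) _.
rewrite tr_momdiag -fE.
rewrite (_ : (fun x => _) = evalp (f - mpolyC n lam)); last first.
  by apply/funext => x; rewrite /evalp mevalB mevalC.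
have CE c : - mpolyC n c = - c *: mpolyX R mnm0.
  by rewrite mpolyX0 -mul_mpolyC mulr1 mpolyCN.
rewrite Rintegral_evalp // !LyD lerD2l !CE !LyZ LyX.
by rewrite ler_wpM2r ?moments0_ge0 // lerN2.
Qed.

Lemma HU_sos_exact (R : realType) n m k (f : mpoly n R) (g : 'I_m.+1 -> mpoly n R)
    eps l mid (G : forall i : 'I_m.+1, 'M[R]_(blk g k i)) :
  0 < eps -> (forall i, l1norm (g i) <= 1) ->
  sos_feasible f g k l G -> \tr (mxdiag G) <= 1 ->
  con_HU f g k eps mid false -> mid <= mcoeff mnm0 f - l.
Proof.
move=> e0 g1 /sos_feasible_gram [pG fE] tr1 hu; rewrite leNgt; apply/negP => lt.
(* The slack entry brings the trace up to 1 and is invisible to every constraint. *)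
pose X := block_mx (mxdiag G) 0 0 ((1 - \tr (mxdiag G))%:M : 'M[R]_1).
have pX : psd X by apply: psd_block_diag; rewrite ?subr_ge0.
have X1 : \tr X = 1.
  by rewrite mxtrace_block mxtrace_scalar mulr1n addrC subrK.
have XE e : \tr (slack (Bgmx g k e) *m X) = mcoeff e f - l * (e == mnm0)%:R.
  by rewrite tr_slack_mul block_mxKul tr_Bgmx -fE mcoeffB mcoeffC.
(* Block 0 contains the constant monomial and the slack adds one more row, so the size is at least
   2, as [HU_exact] requires. *)
have N1 : (1 < \sum_i blk g k i + 1)%N.
  rewrite addn1 ltnS (bigD1 ord0) //= addn_gt0; apply/orP; left.
  by apply/card_gt0P; exists (BMultinom (leq_ltn_trans (eq_leq mdeg0) (ltn0Sn _))).
apply: (HU_exact N1 e0 _ _ pX X1 _ hu) => j.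
- by apply: bs_mx_trmx => [|e]; apply: slack_trmx; exact: Bgmx_trmx.
- by apply: bs_mx_contraction => [|e]; apply: contraction_slack; exact: contraction_Bgmx.
case: j => [[e|e]|[]] /=.
- by rewrite XE (negbTE (valP e)) mulr0 subr0.
- by rewrite mulNmx linearN /= XE (negbTE (valP e)) mulr0 subr0.
- by rewrite XE eqxx mulr1 ltW.
Qed.

(** The Gram polynomial [q] of the approximate solution has [Ly (pad y) q >= 0]; its nonconstant
    coefficients are within [eps] of those of [f], and its constant one is at most [mid + eps]. *)
Lemma HU_moment_approx (R : realType) n m k (f : mpoly n R) (g : 'I_m.+1 -> mpoly n R)
    eps l mid (y : bmultinom n (2 * k).+1 -> R) :
  g ord0 = 1 -> mom_feasible g k y -> Ly (pad y) f = l ->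
  con_HU f g k eps mid true ->
  mcoeff mnm0 f - l <= mid + eps * \sum_e `|y e|.
Proof.
move=> g0 [y0 pM pL] <- hu.
have [||P [pP _ PA]] := HU_approx _ _ hu; first by rewrite addn1.
  by move=> j; apply: bs_mx_trmx => [|e]; apply: slack_trmx; exact: Bgmx_trmx.
have pP0 := psd_ulsubmx pP; set P0 := ulsubmx P in pP0.
pose q := gram_poly P0.
have PE e : \tr (slack (Bgmx g k e) *m P) = mcoeff e q.
  by rewrite tr_slack_mul tr_Bgmx.
have q0 : mcoeff mnm0 q <= mid + eps by have := PA (inr tt); rewrite /= PE.
have qe (e : bmultinom n (2 * k).+1) : bmnm e != mnm0 ->
    `|mcoeff (bmnm e) q - mcoeff (bmnm e) f| <= eps.
  move=> ne; pose z : nzmon n k := exist _ e ne.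
  have := PA (inl (inl z)); have := PA (inl (inr z)).
  rewrite /= mulNmx linearN /= !PE /= ler_norml => h1 h2; lra.
have Ly0 : 0 <= Ly (pad y) q.
  rewrite -tr_momdiag tr_mxdiag_mul sumr_ge0 // => i _.
  apply: psd_tr_mul_ge0; last exact: psd_mxsub.
  have [->|i0] := eqVneq i ord0; last by apply: pL; rewrite lt0n.
  suff : psd (locmx (k - halfdeg (g ord0)) (g ord0) (pad y)) by [].
  rewrite g0 /halfdeg msize1 subn0; move: pM; congr psd; apply/matrixP => a c.
  by rewrite locmxE mul1r LyX mxE.
have z0 : (mdeg (mnm0 : multinom n) < (2 * k).+1)%N by rewrite mdeg0.
pose z := BMultinom z0.
have yz : y z = 1 by move: y0; rewrite /pad -[mnm0]/(bmnm z) valK.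
have LyE p : Ly (pad y) p =
    mcoeff mnm0 p + \sum_(e | e != z) mcoeff (bmnm e) p * y e.
  by rewrite Ly_pad (bigD1 z) //= yz mulr1.
have : \sum_(e | e != z) mcoeff (bmnm e) q * y e <=
    \sum_(e | e != z) mcoeff (bmnm e) f * y e + eps * \sum_(e | e != z) `|y e|.
  rewrite mulr_sumr -big_split; apply: ler_sum => e ez /=.
  rewrite -lerBlDl -mulrBl (le_trans (ler_norm _)) // normrM ler_wpM2r //.
  by apply: qe; rewrite -(inj_eq val_inj) in ez.
(* The error [eps] on the constant coefficient is the share of [y z = 1] in the full sum. *)
have -> : \sum_e `|y e| = 1 + \sum_(e | e != z) `|y e|.
  by rewrite (bigD1 z) //= yz normr1.
rewrite !LyE mulrDr mulr1 in Ly0 *.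
move: (eps * _) (\sum_(e | _) _ * _) (\sum_(e | _) _ * _) Ly0 => K S1 S2; lra.
Qed.

(** The final width [w] costs one [eps] and the pairing with the moments costs [eps * S]. *)
Lemma error_arith (R : realFieldType) (eps f0 l out w p S : R) :
  0 < eps -> out <= f0 - l -> f0 - l <= out + w + p -> w <= eps -> p <= eps * S ->
  0 <= f0 - out - l <= eps * (2 + S).
Proof. by move=> *; apply/andP; split; lra. Qed.

Theorem theorem3 (R : realType) (n m k : nat) (f : mpoly n R)
    (g : 'I_m.+1 -> mpoly n R) (r c eps lam : R) (a : n.-tuple R)
    (heps : 0 < eps)
    (hm : (0 < m)%N)
    (hr : 0 < r < 1)
    (hc : 0 < c)
    (hg0 : g ord0 = 1)
    (hg1 : g (inord 1) = ball_poly n c r)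
    (hkf : (halfdeg f <= k)%N)
    (hkg : forall i : 'I_m.+1, (halfdeg (g i) <= k)%N)
    (hlam : (lam%:E <= sos_value f g k)%E)
    (hmu : exists mu : {measure set (n.-tuple R) -> \bar R},
        [/\ finite_moments mu,
            mu (~` Sset g) = 0%E,
            0 < lambda_min (momdiag g k (moments mu)) &
            Rintegral mu setT (fun x => evalp f x - lam) /
              lambda_min (momdiag g k (moments mu)) <= 1])
    (hl1 : forall i : 'I_m.+1, (0 < i)%N -> l1norm (g i) <= 1)
    (hsd : strong_duality f g k)
    (ha : Sset g a)
    (hbs : mcoeff mnm0 f - evalp f a < mcoeff mnm0 f - lam)
    (lamk : R)
    (hlamk : CON f g k eps lam a lamk) :
  (0 <= lamk%:E - sos_value f g k <=
    (eps * (2 + 1 / (1 - r) *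
       Num.sqrt (1 / 2 * 'C(n + k, n)%:R * ('C(n + k, n)%:R + 1))))%:E)%E.
Proof.
case: hsd => sm [l [G [hG lE]]] [y [hy yE]].
have Lyl : Ly (pad y) f = l by apply: EFin_inj; rewrite yE -sm lE.
have laml : lam <= l by rewrite -lee_fin lE.
have g1 (i : 'I_m.+1) : l1norm (g i) <= 1.
  have [->|i0] := eqVneq i ord0; last by apply: hl1; rewrite lt0n.
  by rewrite hg0 /l1norm msupp1 big_seq1 mcoeff1 eqxx normr1.
have trG : \tr (mxdiag G) <= 1.
  by case: hmu => mu [mufin _ lm0 mule]; exact: sos_tr_le1 mufin lm0 mule laml hG.
have lfa : l <= evalp f a := sos_le_evalp hg0 hG ha.
set S := 1 / (1 - r) * Num.sqrt _.
have yS : \sum_e `|y e| <= S.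
  case: hy => y0 pM pL.
  (* Since [0 < m], [inord 1] is the genuine index 1, and [pL] supplies the ball constraint. *)
  have := pL (inord 1); rewrite hg1 inordK // => /(_ isT) pL1.
  under eq_bigr => e _.
    rewrite (_ : y e = pad y (bmnm e)); last by rewrite /pad valK.
    over.
  apply: le_trans (sum_abs_moments_le pM) _.
  apply: ler_pM; rewrite ?sqrtr_ge0 //.
  - by apply: sumr_ge0 => i _; exact: psd_diag_ge0.
  - exact: tr_momentmx_le hr hc y0 pM pL1.
  rewrite ler_wsqrtr // ler_pM ?mulr_ge0 ?lerD2r ?ler_wpM2l ?ler_nat ?nmon_le //.
have s0 : 0 <= eps * \sum_e `|y e| by rewrite mulr_ge0 ?(ltW heps) ?sumr_ge0.
case: hlamk => out [hBS ->].
have lo : mcoeff mnm0 f - evalp f a <= mcoeff mnm0 f - l by rewrite lerD2l lerN2.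
(* The initial upper end is valid because [lam <= l], even before the nonnegative error term is
   added. *)
have hi : mcoeff mnm0 f - l <= mcoeff mnm0 f - lam + eps * \sum_e `|y e|.
  by rewrite -[leLHS]addr0 lerD // lerD2l lerN2.
have /andP[h1 h2] := BS_loop_bracket
  (fun mid => @HU_sos_exact _ _ _ _ _ _ _ _ mid _ heps g1 hG trG)
  (fun mid => @HU_moment_approx _ _ _ _ _ _ _ _ mid _ hg0 hy Lyl) lo hi hBS.
have w0 : 0 < mcoeff mnm0 f - lam - (mcoeff mnm0 f - evalp f a) by rewrite subr_gt0.
have h3 : eps * \sum_e `|y e| <= eps * S by rewrite ler_pM2l.
rewrite -lE -EFinB !lee_fin.
exact: error_arith heps h1 h2 (bisection_width heps w0) h3.
Qed.
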